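(* Let $\mathcal{A}\in\mathbb{R}^{n_1\times\cdots\times n_d}$ with $d\ge 2$, let $p\in\{1,\dots,d\}$ and $\varepsilon\ge 0$. Let $\mathcal{G}^{(1)},\dots,\mathcal{G}^{(d)}$ be the cores output by the sparse TT conversion procedure (described below) on $(\mathcal{A},p)$, and let $\mathcal{B}$ be the TT tensor output by the static-tolerance TT-rounding procedure (described below) applied to these cores with parameters $\varepsilon$ and $p$. Then $\|\mathcal{A}-\mathcal{B}\|_F\le\varepsilon\|\mathcal{A}\|_F$.
   Context: TT format: cores $\mathcal{G}^{(k)}\in\mathbb{R}^{r_{k-1}\times n_k\times r_k}$, $r_0=r_d=1$, represent the tensor with entries $\mathcal{G}^{(1)}(:,i_1,:)\cdots\mathcal{G}^{(d)}(:,i_d,:)$. For a core $\mathcal{G}\in\mathbb{R}^{a\times n\times b}$: $\mathbf{L}(\mathcal{G})\in\mathbb{R}^{an\times b}$, $\mathbf{L}(\mathcal{G})_{(i-1)n+j,\,l}=\mathcal{G}(i,j,l)$; $\mathbf{R}(\mathcal{G})\in\mathbb{R}^{a\times nb}$, $\mathbf{R}(\mathcal{G})_{i,\,(j-1)b+l}=\mathcal{G}(i,j,l)$. A $p$-fiber of $\mathcal{A}$ is a vector $\mathcal{A}(i_1,\dots,i_{p-1},:,i_{p+1},\dots,i_d)\in\mathbb{R}^{n_p}$. $\operatorname{Depar}$: given $\mathbf{M}\in\mathbb{R}^{a\times b}$, process columns $j=1,\dots,b$ in order keeping an ordered list $K$ of kept columns: if $\mathbf{M}_{:,j}=cK_i$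 for some kept $K_i$ and scalar $c$ (first such $i$), set $T_{i,j}=c$; otherwise append $\mathbf{M}_{:,j}$ to $K$ and set $T_{|K|,j}=1$; other entries of $\mathbf{T}$ zero. Output $\mathbf{N}=[K_1\cdots K_\beta]$, $\mathbf{T}\in\mathbb{R}^{\beta\times b}$. Sparse TT conversion on $(\mathcal{A},p)$: enumerate nonzero $p$-fibers as $j=1,\dots,R$ with fixed indices $(i^{(j)}_1,\dots,i^{(j)}_{p-1},i^{(j)}_{p+1},\dots,i^{(j)}_d)$ and values $\mathbf{v}_j$. Initial TT with ranks $r_0=r_d=1$, $r_k=R$ otherwise: for $k\neq p$, $\mathcal{G}^{(k)}(a,i,b)=1$ if $i=i^{(j)}_k$, where $j=b$ if $k=1$, $j=a$ if $k=d$, and $a=b=j$ is required if $1<k<d$, else $0$; $\mathcal{G}^{(p)}(a,i,b)=\mathbf{v}_j(i)$ with $j$ by the same rule, else $0$. Then for $k=1,\dots,p-1$: $(\mathbf{N},\mathbf{T})=\operatorname{Depar}(\mathbf{L}(\mathcal{G}^{(k)}))$, replace $\mathcal{G}^{(k)}$ by the core with $\mathbf{L}$-unfolding $\mathbf{N}$, and each slice $\mathcal{G}^{(k+1)}(:,i,:)$ by $\mathbf{T}\mathcal{G}^{(k+1)}(:,i,:)$. Then for $k=d,\dots,p+1$: $(\mathbf{N},\mathbf{T})=\operatorname{Depar}(\mathbf{R}(\mathcal{G}^{(k)})^T)$, replace $\mathcal{G}^{(k)}$ by the core with $\mathbf{R}$-unfolding $\mathbf{N}^T$, and each slice $\mathcal{G}^{(k-1)}(:,i,:)$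 by $\mathcal{G}^{(k-1)}(:,i,:)\mathbf{T}^T$. The output cores represent $\mathcal{A}$ exactly. $\delta$-truncated SVD of a matrix $\mathbf{G}$ with SVD $\mathbf{G}=\sum_i\sigma_i\mathbf{u}_i\mathbf{v}_i^T$ ($\sigma_1\ge\sigma_2\ge\cdots$): take the smallest $r$ with $\sum_{i>r}\sigma_i^2\le\delta^2$, $\mathbf{U}=[\mathbf{u}_1\cdots\mathbf{u}_r]$, $\boldsymbol{\Sigma}=\mathrm{diag}(\sigma_1,\dots,\sigma_r)$, $\mathbf{V}=[\mathbf{v}_1\cdots\mathbf{v}_r]$, error $\mathbf{E}=\mathbf{G}-\mathbf{U}\boldsymbol{\Sigma}\mathbf{V}^T$ (so $\|\mathbf{E}\|_F\le\delta$). Static-tolerance TT-rounding with $(\varepsilon,p)$: set $\delta_k=\frac{\varepsilon}{\sqrt{p-1}+\sqrt{d-p}}\|\mathcal{A}\|_F$ for all $k$. (First SVD-sweep) for $k=p,\dots,d-1$: compute the $\delta_k$-truncated SVD $\mathbf{L}(\mathcal{G}^{(k)})=\mathbf{U}\boldsymbol{\Sigma}\mathbf{V}^T+\mathbf{E}_k$, set $r_k$ to the number of columns of $\mathbf{U}$, replace $\mathcal{G}^{(k)}$ by the core with $\mathbf{L}$-unfolding $\mathbf{U}$, and each slice $\mathcal{G}^{(k+1)}(:,i,:)$ by $\boldsymbol{\Sigma}\mathbf{V}^T\mathcal{G}^{(k+1)}(:,i,:)$. (QR-sweep) for $k=d,\dots,p+1$: compute an economic QR decomposition $\mathbf{R}(\mathcal{G}^{(k)})^T=\mathbf{Q}\mathbf{R}$,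 replace $\mathcal{G}^{(k)}$ by the core with $\mathbf{R}$-unfolding $\mathbf{Q}^T$ and each slice $\mathcal{G}^{(k-1)}(:,i,:)$ by $\mathcal{G}^{(k-1)}(:,i,:)\mathbf{R}^T$. (Second SVD-sweep) for $k=p,\dots,2$: compute the $\delta_{k-1}$-truncated SVD $\mathbf{R}(\mathcal{G}^{(k)})^T=\mathbf{U}\boldsymbol{\Sigma}\mathbf{V}^T+\mathbf{E}_{k-1}$, replace $\mathcal{G}^{(k)}$ by the core with $\mathbf{R}$-unfolding $\mathbf{U}^T$ and each slice $\mathcal{G}^{(k-1)}(:,i,:)$ by $\mathcal{G}^{(k-1)}(:,i,:)\mathbf{V}\boldsymbol{\Sigma}$. Return the resulting cores as the TT $\mathcal{B}$. *)

(* Defs.v *)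
(* Real scalars: an arbitrary [R : realType].
   Conventions: all indices (modes, ranks, rows, columns) are 0-based.
   The paper's mode k (1..d) is our mode k-1; the paper's p is kept as the
   1-based argument of the statement and [p.-1] is the 0-based mode.
   Matrices and cores are represented as plain functions on nat together with
   explicit dimensions carried alongside; only in-range entries are ever used
   (all contractions are bounded sums). *)
From mathcomp Require Import all_boot all_order all_algebra.
From mathcomp Require Import reals.
Set Implicit Arguments. Unset Strict Implicit. Unset Printing Implicit Defensive.
Import Order.TTheory GRing.Theory Num.Theory.
Local Open Scope ring_scope.

Definition upd {X : Type} (f : nat -> X) (k : nat) (x : X) : nat -> X :=
  fun k' => if k' == k then x else f k'.

Fixpoint mindices (ns : seq nat) : seq (seq nat) :=
  if ns is m :: ns' then [seq i :: t | i <- iota 0 m, t <- mindices ns']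
  else [:: [::]].

Section TTdefs.
Variable R : realType.

Definition mat := nat -> nat -> R.
Definition core := nat -> nat -> nat -> R.

(* A TT: ranks r_0..r_d (rk k) and cores (cr k), core k has size
   rk k x n_k x rk k.+1 *)
Record TT := MkTT { rk : nat -> nat; cr : nat -> core }.

Definition ns_at (ns : seq nat) (k : nat) : nat := nth 0%N ns k.

Definition normF (ns : seq nat) (A : seq nat -> R) : R :=
  Num.sqrt (\sum_(ix <- mindices ns) A ix ^+ 2).

(* entry of the tensor represented by a TT with d cores:
   G^(1)(:,i_1,:) ... G^(d)(:,i_d,:) (r_0 = r_d = 1) *)
Fixpoint ttv (t : TT) (ix : seq nat) (k : nat) : nat -> R :=
  if k is k'.+1 then
    fun b => \sum_(a < rk t k') ttv t ix k' a * cr t k' a (nth 0%N ix k') b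
  else fun a => (a == 0%N)%:R.
Definition tt_eval (d : nat) (t : TT) (ix : seq nat) : R := ttv t ix d 0%N.

Definition trm (M : mat) : mat := fun i j => M j i.
Definition Lunf (n : nat) (G : core) : mat := fun row l => G (row %/ n)%N (row %% n)%N l.
Definition Runf (b : nat) (G : core) : mat := fun i col => G i (col %/ b)%N (col %% b)%N.
Definition core_of_L (n : nat) (N : mat) : core := fun a i b => N (a * n + i)%N b.
Definition core_of_R (b : nat) (N : mat) : core := fun a i l => N a (i * b + l)%N.
Definition lmul_slices (k : nat) (T : mat) (G : core) : core :=
  fun a i b => \sum_(l < k) T a l * G l i b.
Definition rmul_slices (k : nat) (G : core) (T : mat) : core :=
  fun a i b => \sum_(l < k) G a i l * T l b.

Definition set_entry (T : mat) (i j : nat) (v : R) : mat :=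
  fun i' j' => if (i' == i) && (j' == j) then v else T i' j'.
Definition set_col (N : mat) (c : nat) (v : nat -> R) : mat :=
  fun r c' => if c' == c then v r else N r c'.

Definition scal_col (a : nat) (M : mat) (j : nat) (N : mat) (i : nat) (c : R) :=
  forall r, (r < a)%N -> M r j = c * N r i.

(* depar_run a M j beta N T : after processing columns 0..j-1 of M (a rows),
   beta columns are kept (N = [K_1 ... K_beta]) and T (beta x j) is built. *)
Inductive depar_run (a : nat) (M : mat) : nat -> nat -> mat -> mat -> Prop :=
| Depar0 : depar_run a M 0 0 (fun _ _ => 0) (fun _ _ => 0)
| DeparOld j beta N T i c :
    depar_run a M j beta N T -> (i < beta)%N -> scal_col a M j N i c ->
    (forall i', (i' < i)%N -> ~ exists c', scal_col a M j N i' c') ->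
    depar_run a M j.+1 beta N (set_entry T i j c)
| DeparNew j beta N T :
    depar_run a M j beta N T ->
    (forall i, (i < beta)%N -> ~ exists c, scal_col a M j N i c) ->
    depar_run a M j.+1 beta.+1 (set_col N beta (fun r => M r j)) (set_entry T beta j 1).

Definition depar (a b : nat) (M : mat) (beta : nat) (N T : mat) : Prop :=
  depar_run a M b beta N T.

Inductive sweep (step : TT -> TT -> nat -> Prop) : seq nat -> TT -> TT -> Prop :=
| sweep_nil t : sweep step [::] t t
| sweep_cons k ks t t1 t2 : step t t1 k -> sweep step ks t1 t2 -> sweep step (k :: ks) t t2.

(* fib enumerates the nonzero p-fibers (p0 = 0-based mode): each element is a
   full multi-index whose p0-th entry is 0 (placeholder), listing the fixed
   indices (i_k)_{k <> p} of a nonzero fiber, each exactly once. *)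
Definition fiber_enum (ns : seq nat) (p0 : nat) (A : seq nat -> R)
    (fib : seq (seq nat)) : Prop :=
  uniq fib /\
  forall ix, ix \in fib <->
    (ix \in mindices (set_nth 0%N ns p0 1%N) /\
     exists i, (i < ns_at ns p0)%N /\ A (set_nth 0%N ix p0 i) != 0).

Definition init_tt (d p0 : nat) (A : seq nat -> R) (fib : seq (seq nat)) : TT :=
  MkTT (fun k => if (k == 0%N) || (k == d) then 1%N else size fib)
       (fun k a i b =>
          let j := if k == 0%N then b else a in
          if (k == 0%N) || (k == d.-1) || (a == b) then
            if k == p0 then A (set_nth 0%N (nth [::] fib j) p0 i)
            else (i == nth 0%N (nth [::] fib j) k)%:R
          else 0).

Definition conv_left (ns : seq nat) (t t' : TT) (k : nat) : Prop :=
  exists beta N T,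
    depar (rk t k * ns_at ns k) (rk t k.+1) (Lunf (ns_at ns k) (cr t k)) beta N T /\
    t' = MkTT (upd (rk t) k.+1 beta)
              (upd (upd (cr t) k (core_of_L (ns_at ns k) N))
                   k.+1 (lmul_slices (rk t k.+1) T (cr t k.+1))).

Definition conv_right (ns : seq nat) (t t' : TT) (k : nat) : Prop :=
  exists beta N T,
    depar (ns_at ns k * rk t k.+1) (rk t k) (trm (Runf (rk t k.+1) (cr t k))) beta N T /\
    t' = MkTT (upd (rk t) k beta)
              (upd (upd (cr t) k (core_of_R (rk t k.+1) (trm N)))
                   k.-1 (rmul_slices (rk t k) (cr t k.-1) (trm T))).

Definition sparse_tt (ns : seq nat) (p : nat) (A : seq nat -> R)
    (fib : seq (seq nat)) (t : TT) : Prop :=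
  let d := size ns in let p0 := p.-1 in
  exists tm,
    sweep (conv_left ns) (iota 0 p0) (init_tt d p0 A fib) tm /\
    sweep (conv_right ns) (rev (iota p0.+1 (d - p0.+1))) tm t.

Definition orthocols (m q : nat) (U : mat) : Prop :=
  forall j1 j2, (j1 < q)%N -> (j2 < q)%N ->
    \sum_(i < m) U i j1 * U i j2 = (j1 == j2)%:R.

Definition is_svd (m n : nat) (G U : mat) (s : nat -> R) (V : mat) : Prop :=
  let q := minn m n in
  [/\ orthocols m q U, orthocols n q V,
      (forall i, (i < q)%N -> 0 <= s i),
      (forall i, (i.+1 < q)%N -> s i.+1 <= s i) &
      forall i j, (i < m)%N -> (j < n)%N -> G i j = \sum_(l < q) U i l * s l * V j l].

Definition tail_sq (s : nat -> R) (r q : nat) : R := \sum_(r <= i < q) s i ^+ 2.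

(* delta-truncated SVD: (U, s, V) is an SVD of G and r is the smallest rank
   with sum_{i >= r} s_i^2 <= delta^2; the truncated factors are the first r
   columns of U and V and s_0..s_{r-1} (all later uses only read those). *)
Definition trunc_svd (delta : R) (m n : nat) (G : mat) (r : nat)
    (U : mat) (s : nat -> R) (V : mat) : Prop :=
  is_svd m n G U s V /\ (r <= minn m n)%N /\
  tail_sq s r (minn m n) <= delta ^+ 2 /\
  forall r', (r' < r)%N -> delta ^+ 2 < tail_sq s r' (minn m n).

Definition is_econ_qr (m n : nat) (X Q Rm : mat) : Prop :=
  let q := minn m n in
  [/\ orthocols m q Q,
      (forall i j, (j < i)%N -> (i < q)%N -> (j < n)%N -> Rm i j = 0) &
      forall i j, (i < m)%N -> (j < n)%N -> X i j = \sum_(l < q) Q i l * Rm l j].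

Definition round_svd1 (ns : seq nat) (delta : R) (t t' : TT) (k : nat) : Prop :=
  let m := (rk t k * ns_at ns k)%N in let n := rk t k.+1 in
  exists r U s V,
    trunc_svd delta m n (Lunf (ns_at ns k) (cr t k)) r U s V /\
    t' = MkTT (upd (rk t) k.+1 r)
              (upd (upd (cr t) k (core_of_L (ns_at ns k) U))
                   k.+1 (lmul_slices n (fun a l => s a * V l a) (cr t k.+1))).

Definition round_qr (ns : seq nat) (t t' : TT) (k : nat) : Prop :=
  let m := (ns_at ns k * rk t k.+1)%N in let n := rk t k in
  exists Q Rm,
    is_econ_qr m n (trm (Runf (rk t k.+1) (cr t k))) Q Rm /\
    t' = MkTT (upd (rk t) k (minn m n))
              (upd (upd (cr t) k (core_of_R (rk t k.+1) (trm Q)))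
                   k.-1 (rmul_slices n (cr t k.-1) (trm Rm))).

Definition round_svd2 (ns : seq nat) (delta : R) (t t' : TT) (k : nat) : Prop :=
  let m := (ns_at ns k * rk t k.+1)%N in let n := rk t k in
  exists r U s V,
    trunc_svd delta m n (trm (Runf (rk t k.+1) (cr t k))) r U s V /\
    t' = MkTT (upd (rk t) k r)
              (upd (upd (cr t) k (core_of_R (rk t k.+1) (trm U)))
                   k.-1 (rmul_slices n (cr t k.-1) (fun l b => V l b * s b))).

Definition tt_round_static (ns : seq nat) (p : nat) (eps nrmA : R) (t t' : TT) : Prop :=
  let d := size ns in let p0 := p.-1 in
  let delta := eps / (Num.sqrt (p - 1)%:R + Num.sqrt (d - p)%:R) * nrmA in
  exists t1 t2,
    sweep (round_svd1 ns delta) (iota p0 (d.-1 - p0)) t t1 /\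
    sweep (round_qr ns) (rev (iota p0.+1 (d - p0.+1))) t1 t2 /\
    sweep (round_svd2 ns delta) (rev (iota 1 p0)) t2 t'.

End TTdefs.

(* Main.v *)
(* After the sparse conversion the cores before mode p have left unfoldings with
   distinct unit vectors as columns (Depar only merges equal columns), so they are
   left-orthogonal; symmetrically the cores after mode p are right-orthogonal.
   Hence a truncation at a given core changes the tensor by exactly the Frobenius
   norm of the discarded part. Within a sweep, everything produced after a
   truncation lies in the range of the new orthonormal interface, to which the
   discarded part is orthogonal: the errors of a sweep are pairwise orthogonal and
   their squares add up. The two sweeps thus contribute sqrt(d-p) delta and
   sqrt(p-1) delta, and the triangle inequality concludes. Right-to-left sweeps
   are treated as left-to-right sweeps on the TT with reversed modes. *)
Require Import Defs.
From mathcomp Require Import all_boot all_order all_algebra.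
From mathcomp Require Import reals zify ring.
Import Order.TTheory GRing.Theory Num.Theory.
Local Open Scope ring_scope.

Section StaticRounding.
Set Implicit Arguments.
Unset Strict Implicit.
Variable R : realType.
Implicit Types (ns ix : seq nat) (t : TT R) (C U M N T : mat R) (A : seq nat -> R).

(** * Interfaces of a TT and abstract orthogonal steps *)

Lemma mindicesP ns ix :
  reflect (size ix = size ns /\
           forall k, (k < size ns)%N -> (nth 0%N ix k < nth 0%N ns k)%N)
          (ix \in mindices ns).
Proof.
elim: ns ix => [|m ns IH] ix /=.
  rewrite inE; apply: (iffP eqP) => [->//|[/size0nil]//].
apply: (iffP allpairsP) => [[[i y] /= [im yns ->]]|[sz lt]].
  move: im; rewrite mem_iota add0n => im.
  case/IH: yns => sz lt; split; first by rewrite /= sz.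
  by case=> [|k] //= kns; exact: lt.
case: ix sz lt => // i y [sz] lt; exists (i, y); split=> //.
  by rewrite mem_iota; exact: (lt 0%N).
by apply/IH; split=> // k kns; exact: (lt k.+1).
Qed.

Lemma big_mindices_cat (s1 s2 : seq nat) (F : seq nat -> R) :
  \sum_(ix <- mindices (s1 ++ s2)) F ix =
  \sum_(l <- mindices s1) \sum_(y <- mindices s2) F (l ++ y).
Proof.
elim: s1 F => [|m s1 IH] F; first by rewrite big_seq1.
rewrite /= !big_allpairs_dep; apply: eq_bigr => i _.
exact: (IH (fun x => F (i :: x))).
Qed.

Lemma big_mindices_cons m (s : seq nat) (F : seq nat -> R) :
  \sum_(ix <- mindices (m :: s)) F ix =
  \sum_(i < m) \sum_(y <- mindices s) F (nat_of_ord i :: y).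
Proof.
rewrite /= big_allpairs_dep.
rewrite -(big_mkord xpredT (fun i => \sum_(y <- mindices s) F (i :: y))).
by rewrite /index_iota subn0.
Qed.

Lemma big_mindices_rcons (s : seq nat) m (F : seq nat -> R) :
  \sum_(ix <- mindices (rcons s m)) F ix =
  \sum_(l <- mindices s) \sum_(i < m) F (rcons l (nat_of_ord i)).
Proof.
rewrite -cats1 big_mindices_cat; apply: eq_bigr => l _.
rewrite big_mindices_cons; apply: eq_bigr => i _.
by rewrite big_seq1 cats1.
Qed.

Lemma big_mindices_rev ns (F : seq nat -> R) :
  \sum_(ix <- mindices (rev ns)) F ix = \sum_(ix <- mindices ns) F (rev ix).
Proof.
elim: ns F => [|m ns IH] F; first by rewrite !big_seq1.
rewrite rev_cons big_mindices_rcons IH big_mindices_cons exchange_big /=.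
by apply: eq_bigr => y _; apply: eq_bigr => i _; rewrite rev_cons.
Qed.

Lemma mem_mindices_rev ns ix : ix \in mindices ns -> rev ix \in mindices (rev ns).
Proof.
case/mindicesP=> sz lt; apply/mindicesP; rewrite !size_rev; split=> // k kn.
rewrite !nth_rev ?sz //; apply: lt; lia.
Qed.

(** * Mode reversal and right interfaces *)

Definition revT d t : TT R :=
  MkTT (fun k => rk t (d - k)%N) (fun k a i b => cr t (d.-1 - k)%N b i a).

(** The right interface: the product of the slices of cores [k], ..., [d-1] selected by [ix], as a
    vector over rank [k]. Obtaining it as a left interface of the reversed TT lets every result on
    [ttv] apply to it. *)
Definition rttv d t ix k := ttv (revT d t) (rev ix) (d - k).

Lemma eq_ttv t t' ix ix' k :
  (forall j, (j < k)%N -> rk t j = rk t' j) ->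
  (forall j a i b, (j < k)%N -> cr t j a i b = cr t' j a i b) ->
  (forall j, (j < k)%N -> nth 0%N ix j = nth 0%N ix' j) ->
  forall b, ttv t ix k b = ttv t' ix' k b.
Proof.
elim: k => [//|k IH] Hr Hc Hx b /=.
rewrite Hr // Hx //; apply: eq_bigr => a _; rewrite Hc //; congr (_ * _).
by apply: IH => *; [apply: Hr|apply: Hc|apply: Hx]; apply: ltnW.
Qed.

Lemma ttvS t ix k b : ttv t ix k.+1 b =
  \sum_(a < rk t k) ttv t ix k a * cr t k a (nth 0%N ix k) b.
Proof. by []. Qed.

Lemma rttv_step d t ix k a : size ix = d -> (k < d)%N ->
  rttv d t ix k a =
  \sum_(b < rk t k.+1) cr t k a (nth 0%N ix k) b * rttv d t ix k.+1 b.
Proof.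
move=> sz kd; rewrite /rttv (_ : (d - k)%N = (d - k.+1).+1); last by lia.
rewrite /= nth_rev ?sz; last by lia.
rewrite (_ : (d - (d - k.+1).+1)%N = k); last by lia.
rewrite (_ : (d - (d - k.+1))%N = k.+1); last by lia.
rewrite (_ : (d.-1 - (d - k.+1))%N = k); last by lia.
by apply: eq_bigr => b _; rewrite mulrC.
Qed.

(** Downward induction from [k = d], where the right interface is 1 at the only index of the
    boundary rank. Each step hands one core over from the left interface to the right one. *)
Lemma tt_eval_split d t ix k : size ix = d -> rk t d = 1%N -> (k <= d)%N ->
  tt_eval d t ix = \sum_(a < rk t k) ttv t ix k a * rttv d t ix k a.
Proof.
move=> sz rd kd; rewrite -(subKn kd); elim: (d - k)%N (leq_subr k d) => [|m IH] md.
  by rewrite subn0 rd big_ord1 /rttv subnn mulr1.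
rewrite {}IH; last exact: ltnW.
have -> : (d - m)%N = (d - m.+1).+1 by lia.
set k' := (d - m.+1)%N; have k'd : (k' < d)%N by lia.
under eq_bigr do rewrite ttvS mulr_suml.
rewrite exchange_big; apply: eq_bigr => a _.
rewrite (rttv_step _ _ sz k'd) mulr_sumr; apply: eq_bigr => b _; ring.
Qed.

Lemma tt_eval_rev d t ix : size ix = d -> rk t 0 = 1%N -> rk t d = 1%N ->
  tt_eval d (revT d t) (rev ix) = tt_eval d t ix.
Proof.
move=> sz r0 rd; rewrite (tt_eval_split sz rd (leq0n d)) r0 big_ord1 mul1r.
by rewrite /rttv subn0.
Qed.

(** * Orthogonality of cores and of interfaces *)

(** Orthonormality of the columns of the left unfolding, with the row kept as a pair [(a, i)]: the
    two unfoldings flatten this pair in opposite orders after mode reversal, and the double sum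
    serves both. *)
Definition lorth ns t k := forall b b',
  (b < rk t k.+1)%N -> (b' < rk t k.+1)%N ->
  \sum_(a < rk t k) \sum_(i < ns_at ns k) cr t k a i b * cr t k a i b' =
  (b == b')%:R.

Lemma lorth_eq ns ns' t t' k :
  ns_at ns' k = ns_at ns k ->
  rk t' k = rk t k -> rk t' k.+1 = rk t k.+1 ->
  (forall a i b, cr t' k a i b = cr t k a i b) -> lorth ns t k -> lorth ns' t' k.
Proof.
move=> Hn Hr Hr1 Hc H b b'; rewrite Hr1 Hr Hn => /H{}H /H{}H; rewrite -H.
by apply: eq_bigr => a _; apply: eq_bigr => i _; rewrite !Hc.
Qed.

Definition orthon (I : Type) (r : seq I) q (P : I -> nat -> R) :=
  forall a a', (a < q)%N -> (a' < q)%N -> \sum_(l <- r) P l a * P l a' = (a == a')%:R.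

Lemma sum_delta q (a : nat) (F : nat -> R) : (a < q)%N ->
  \sum_(b < q) (a == b)%:R * F b = F a.
Proof.
move=> aq; rewrite (bigD1 (Ordinal aq)) //= eqxx mul1r big1 ?addr0 // => b.
rewrite -val_eqE /= eq_sym => /negbTE ->; exact: mul0r.
Qed.

Lemma ler_of_eq (x y : R) : x = y -> x <= y.
Proof. by move->. Qed.

Lemma ler_sum_ord (F : nat -> R) n i : (i < n)%N -> (forall j, 0 <= F j) ->
  F i <= \sum_(j < n) F j.
Proof.
by move=> lt_in F0; rewrite (bigD1 (Ordinal lt_in)) //= lerDl sumr_ge0.
Qed.

(** An orthonormal family preserves inner products. This is the device by which interfaces are
    removed from all sums over multi-indices below. *)
Lemma parseval (I : Type) (r : seq I) q (P : I -> nat -> R) (x z : nat -> R) :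
  orthon r q P ->
  \sum_(l <- r) (\sum_(a < q) P l a * x a) * (\sum_(a < q) P l a * z a) =
  \sum_(a < q) x a * z a.
Proof.
move=> oP.
transitivity (\sum_(a < q) \sum_(a' < q) x a * z a' * \sum_(l <- r) P l a * P l a').
  under eq_bigr do rewrite mulr_suml.
  rewrite exchange_big; apply: eq_bigr => a _ /=.
  under eq_bigr do rewrite mulr_sumr.
  rewrite exchange_big; apply: eq_bigr => a' _ /=.
  by rewrite mulr_sumr; apply: eq_bigr => l _; ring.
apply: eq_bigr => a _; rewrite -[RHS](sum_delta (fun b => x a * z b) (ltn_ord a)).
by apply: eq_bigr => a' _; rewrite oP // mulrC.
Qed.

(** By induction: the next interface is the current one applied to core [k], so [parseval] with the
    induction hypothesis removes the prefix and leaves the orthogonality relation of core [k]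
    alone. *)
Lemma ttv_orthon ns t k : rk t 0 = 1%N -> (k <= size ns)%N ->
  (forall j, (j < k)%N -> lorth ns t j) ->
  orthon (mindices (take k ns)) (rk t k) (fun l a => ttv t l k a).
Proof.
move=> r0; elim: k => [|k IH] kn H a a'.
  by rewrite r0 !ltnS !leqn0 => /eqP -> /eqP ->; rewrite take0 big_seq1 mulr1.
move=> ak ak'; rewrite (take_nth 0%N) // big_mindices_rcons.
rewrite -(H k) // [RHS]exchange_big [LHS]exchange_big; apply: eq_bigr => i _ /=.
rewrite -(parseval (fun x => cr t k x i a) (fun x => cr t k x i a')
  (IH (ltnW kn) (fun j jk => H j (ltnW jk)))).
rewrite big_seq [RHS]big_seq; apply: eq_bigr => l /mindicesP [sl _].
have sl' : size l = k by rewrite sl size_takel // ltnW.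
have E b : ttv t (rcons l i) k b = ttv t l k b.
  by apply: eq_ttv => // j jk; rewrite nth_rcons sl' jk.
by rewrite /= nth_rcons sl' ltnn eqxx; congr (_ * _); apply: eq_bigr => b _; rewrite E.
Qed.

Definition rorth ns t k := lorth (rev ns) (revT (size ns) t) ((size ns).-1 - k).

Lemma rttv_suffix d t k l (x : nat) y b : size l = k -> size y = (d - k.+1)%N ->
  rttv d t (l ++ x :: y) k.+1 b = ttv (revT d t) (rev y) (d - k.+1) b.
Proof.
move=> sl sy; apply: eq_ttv => // j jk.
by rewrite rev_cat rev_cons cat_rcons nth_cat size_rev sy jk.
Qed.

(** Mirror image of [ttv_orthon]: a prefix of the reversed modes is the reversal of a suffix. *)
Lemma rttv_orthon ns t k : rk t (size ns) = 1%N -> (k < size ns)%N ->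
  (forall j, (k < j < size ns)%N -> rorth ns t j) ->
  orthon (mindices (drop k.+1 ns)) (rk t k.+1)
    (fun y b => ttv (revT (size ns) t) (rev y) (size ns - k.+1) b).
Proof.
set d := size ns => rd kd H a a' ak ak'.
have O : orthon (mindices (take (d - k.+1) (rev ns))) (rk (revT d t) (d - k.+1))
           (fun l a => ttv (revT d t) l (d - k.+1) a).
  apply: ttv_orthon; first by rewrite /= subn0.
    by rewrite size_rev leq_subr.
  move=> j jk; have := H (d.-1 - j)%N; rewrite /rorth -/d.
  by rewrite (_ : (d.-1 - (d.-1 - j))%N = j); [apply; lia|lia].
move: O; rewrite take_rev -/d (subKn kd) /orthon => O.
have rkE : rk (revT d t) (d - k.+1) = rk t k.+1 by rewrite /= subKn.
by rewrite -(O a a') ?rkE // big_mindices_rev.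
Qed.

Lemma big_mindices_split ns k (F : seq nat -> R) : (k < size ns)%N ->
  \sum_(ix <- mindices ns) F ix =
  \sum_(i < ns_at ns k) \sum_(y <- mindices (drop k.+1 ns))
    \sum_(l <- mindices (take k ns)) F (l ++ nat_of_ord i :: y).
Proof.
move=> kn; rewrite -{1}(cat_take_drop k ns) (drop_nth 0%N kn) big_mindices_cat.
under eq_bigr do rewrite big_mindices_cons.
by rewrite exchange_big; apply: eq_bigr => i _; rewrite exchange_big.
Qed.

Definition err t t' k C a i b :=
  cr t k a i b - \sum_(c < rk t' k.+1) cr t' k a i c * C c b.

(* Common abstraction of the Depar, QR and SVD steps: core [k], unfolded to the
   left, is split as [U C + E], where [U] is the new core and [E] is [err]. *)
Definition lstep_by ns (e : R) t t' k C : Prop :=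
  (k.+1 < size ns)%N /\
  [/\ forall j, (j <= size ns)%N -> j != k.+1 -> rk t' j = rk t j,
      forall j a i b, (j < size ns)%N -> j != k -> j != k.+1 ->
        cr t' j a i b = cr t j a i b,
      forall a i b, cr t' k.+1 a i b = \sum_(l < rk t k.+1) C a l * cr t k.+1 l i b &
   [/\ lorth ns t' k,
      forall c b, (c < rk t' k.+1)%N -> (b < rk t k.+1)%N ->
        \sum_(a < rk t k) \sum_(i < ns_at ns k)
          cr t' k a i c * err t t' k C a i b = 0 &
      \sum_(a < rk t k) \sum_(i < ns_at ns k) \sum_(b < rk t k.+1)
          err t t' k C a i b ^+ 2 <= e]].

Definition lstep ns e t t' k : Prop := exists C, lstep_by ns e t t' k C.

(** * Effect and error of a single orthogonal step *)

Section Step.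
Variables (ns : seq nat) (e : R) (t t' : TT R) (k : nat) (C : mat R).
Hypothesis S : lstep_by ns e t t' k C.
Hypotheses (r0 : rk t 0 = 1%N) (rd : rk t (size ns) = 1%N).
Let d := size ns.

Lemma lstep_rk0 : rk t' 0 = 1%N.
Proof. by case: S => kd [Hr _ _ _]; rewrite Hr. Qed.

Lemma lstep_rkd : rk t' d = 1%N.
Proof. by case: S => kd [Hr _ _ _]; rewrite Hr // neq_ltn /d kd orbT. Qed.

Lemma lstep_ttv ix a : ttv t' ix k a = ttv t ix k a.
Proof.
by case: S => kd [Hr Hc _ _]; apply: eq_ttv => // j *; [apply: Hr|apply: Hc];
  rewrite -/d in kd *; lia.
Qed.

Lemma lstep_rttv ix c : size ix = d ->
  rttv d t' ix k.+1 c = \sum_(b < rk t k.+1) C c b * rttv d t ix k.+1 b.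
Proof.
case: S => kd [Hr Hc HC _] sz; rewrite rttv_step //.
under [RHS]eq_bigr do rewrite rttv_step // mulr_sumr.
rewrite [RHS]exchange_big /= Hr //; last by rewrite eqn_leq ltnn.
apply: eq_bigr => x _; rewrite HC mulr_suml.
have -> : rttv d t' ix k.+2 x = rttv d t ix k.+2 x.
  apply: eq_ttv => // j *; rewrite /=; [apply: Hr|apply: Hc]; rewrite -/d in kd *; lia.
by apply: eq_bigr => b _; rewrite mulrA.
Qed.

(** The factor [C] pushed into core [k.+1] can be pulled back next to the new core [k]. Both tensors
    then share their interfaces around core [k], and their difference is the same chain with the
    residual [err] in that place. *)
Lemma lstep_diff ix : size ix = d ->
  tt_eval d t ix - tt_eval d t' ix =
  \sum_(a < rk t k) ttv t ix k a *
    \sum_(b < rk t k.+1) err t t' k C a (nth 0%N ix k) b * rttv d t ix k.+1 b.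
Proof.
case: (S) => kd [Hr _ _ _] sz.
have kd' : (k <= d)%N by rewrite /d; lia.
rewrite (tt_eval_split sz rd kd') (tt_eval_split sz lstep_rkd kd').
rewrite (Hr k) //; last by rewrite neq_ltn ltnSn.
rewrite -sumrB; apply: eq_bigr => a _; rewrite lstep_ttv -mulrBr; congr (_ * _).
rewrite !rttv_step //; try exact: ltnW.
under [X in _ - X]eq_bigr do rewrite (lstep_rttv _ sz) mulr_sumr.
rewrite [X in _ - X]exchange_big -sumrB; apply: eq_bigr => b _ /=.
rewrite /err mulrBl mulr_suml; congr (_ - _).
by apply: eq_bigr => c _; rewrite mulrA.
Qed.

Lemma lstep_exact ix : e <= 0 -> ix \in mindices ns ->
  tt_eval d t' ix = tt_eval d t ix.
Proof.
move=> e0 /mindicesP[sz lt]; apply/esym/eqP; rewrite -subr_eq0 lstep_diff //.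
case: (S) => kd [_ _ _ [_ _ He]].
rewrite big1 // => a _; rewrite big1 ?mulr0 // => b _.
suff -> : err t t' k C a (nth 0%N ix k) b = 0 by rewrite mul0r.
have ik := lt _ (ltnW kd).
(* The square of one residual entry is at most the full triple sum, which is at most [e <= 0]. The
   sum is entered one index at a time with [ler_sum_ord]. *)
apply/eqP; rewrite -sqrf_eq0 eq_le sqr_ge0 andbT (le_trans _ (le_trans He e0)) //.
set F := fun a0 (i : nat) (b0 : nat) => err t t' k C a0 i b0 ^+ 2.
have F1 a0 i : 0 <= \sum_(b0 < rk t k.+1) F a0 i b0.
  by apply: sumr_ge0 => *; apply: sqr_ge0.
have F2 (a0 : nat) : 0 <= \sum_(i < ns_at ns k) \sum_(b0 < rk t k.+1) F a0 i b0.
  by apply: sumr_ge0 => *; apply: F1.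
apply: (le_trans _ (@ler_sum_ord
  (fun a0 => \sum_(i < ns_at ns k) \sum_(b0 < rk t k.+1) F a0 i b0) _ _ (ltn_ord a) F2)).
apply: (le_trans _ (@ler_sum_ord (fun i => \sum_(b0 < rk t k.+1) F a i b0) _ _ ik (F1 a))).
by apply: (@ler_sum_ord (F a _) _ _ (ltn_ord b)) => b0; apply: sqr_ge0.
Qed.

Hypothesis lo : forall j, (j < k)%N -> lorth ns t j.

Let Q y b := ttv (revT d t) (rev y) (d - k.+1) b.

(** The error of the step is paired with any [f] that factors through the same left interface;
    orthonormality of that interface removes the prefix. It is applied to [f] equal to the error
    itself, for its norm, and to [f] equal to a later tensor, for orthogonality. *)
Lemma lstep_inner (f : seq nat -> R) (z : nat -> nat -> seq nat -> R) :
  (forall l i y, size l = k -> size y = (d - k.+1)%N ->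
     f (l ++ i :: y) = \sum_(a < rk t k) ttv t l k a * z a i y) ->
  \sum_(ix <- mindices ns) (tt_eval d t ix - tt_eval d t' ix) * f ix =
  \sum_(i < ns_at ns k) \sum_(a < rk t k) \sum_(y <- mindices (drop k.+1 ns))
    (\sum_(b < rk t k.+1) Q y b * err t t' k C a i b) * z a i y.
Proof.
move=> fE; case: (S) => kd _; have kd' := ltnW kd.
rewrite (big_mindices_split _ kd'); apply: eq_bigr => i _.
rewrite [RHS]exchange_big big_seq [RHS]big_seq; apply: eq_bigr => y.
case/mindicesP=> sy _; rewrite size_drop -/d in sy.
rewrite -(parseval (fun a => \sum_(b < rk t k.+1) Q y b * err t t' k C a i b)
  (fun a => z a i y) (ttv_orthon r0 (ltnW kd') lo)).
rewrite big_seq [RHS]big_seq; apply: eq_bigr => l.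
case/mindicesP=> sl _; have {}sl : size l = k by rewrite sl size_takel // ltnW.
rewrite (fE l i y) // lstep_diff; last by rewrite size_cat sl /= sy /d; lia.
congr (_ * _); apply: eq_bigr => a _; congr (_ * _).
  by apply: eq_ttv => // j jk; rewrite nth_cat sl jk.
by apply: eq_bigr => b _; rewrite rttv_suffix // nth_cat sl ltnn subnn mulrC.
Qed.

Lemma lstep_err_le :
  (forall j, (k < j < d)%N -> rorth ns t j) ->
  \sum_(ix <- mindices ns) (tt_eval d t ix - tt_eval d t' ix) ^+ 2 <= e.
Proof.
move=> ro; case: (S) => kd [_ _ _ [_ _ He]]; apply: le_trans He.
under eq_bigr do rewrite expr2.
rewrite (lstep_inner (z := fun a i y => \sum_(b < rk t k.+1) Q y b * err t t' k C a i b)).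
  rewrite [leRHS]exchange_big /=; apply/ler_of_eq/eq_bigr => i _; apply: eq_bigr => a _.
  (* The right interface is orthonormal as well, so the suffix disappears too and only the Frobenius
     norm of the residual remains. *)
  rewrite (parseval (err t t' k C a i) (err t t' k C a i) (rttv_orthon rd (ltnW kd) ro)).
  by apply: eq_bigr => b _; rewrite expr2.
move=> l i y sl sy; rewrite lstep_diff; last by rewrite size_cat sl /= sy /d; rewrite -/d in kd *; lia.
apply: eq_bigr => a _; congr (_ * _).
  by apply: eq_ttv => // j jk; rewrite nth_cat sl jk.
by apply: eq_bigr => b _; rewrite rttv_suffix // nth_cat sl ltnn subnn mulrC.
Qed.

(* Any TT that keeps the new core [k] has its tensor in the range of the new
   left interface, to which the error of the step is orthogonal. *)
Lemma lstep_err_orth t'' : rk t'' d = 1%N ->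
  (forall j, (j <= k.+1)%N -> rk t'' j = rk t' j) ->
  (forall j a i b, (j <= k)%N -> cr t'' j a i b = cr t' j a i b) ->
  \sum_(ix <- mindices ns)
     (tt_eval d t ix - tt_eval d t' ix) * tt_eval d t'' ix = 0.
Proof.
move=> rd'' Hr'' Hc''; case: (S) => kd [Hr Hc _ [_ Ho _]].
pose w y c := ttv (revT d t'') (rev y) (d - k.+1) c.
rewrite (lstep_inner (z := fun a i y => \sum_(c < rk t' k.+1) cr t' k a i c * w y c)).
  under eq_bigr do rewrite exchange_big.
  rewrite exchange_big big1 // => y _ /=.
  (* The sums over [a] and [i] are moved innermost, where the new core meets the residual and [Ho]
     gives 0. *)
  transitivity (\sum_(b < rk t k.+1) \sum_(c < rk t' k.+1) Q y b * w y c *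
      \sum_(a < rk t k) \sum_(i < ns_at ns k) cr t' k a i c * err t t' k C a i b).
    rewrite exchange_big /=.
    under [RHS]eq_bigr do under eq_bigr do rewrite mulr_sumr.
    under [RHS]eq_bigr do rewrite exchange_big.
    rewrite [RHS]exchange_big; apply: eq_bigr => a _ /=.
    under [RHS]eq_bigr do under eq_bigr do rewrite mulr_sumr.
    under [RHS]eq_bigr do rewrite exchange_big.
    rewrite [RHS]exchange_big; apply: eq_bigr => i _ /=.
    rewrite mulr_suml; apply: eq_bigr => b _; rewrite mulr_sumr.
    by apply: eq_bigr => c _; ring.
  by rewrite big1 // => b _; rewrite big1 // => c _; rewrite Ho ?mulr0.
move=> l i y sl sy.
have sz : size (l ++ i :: y) = d by rewrite size_cat sl /= sy /d; rewrite -/d in kd *; lia.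
(* Cutting [t''] after core [k] and then detaching that core exhibits the factorization that
   [lstep_inner] asks for. *)
rewrite (tt_eval_split (k := k.+1) sz rd'' (ltnW kd)) Hr'' //.
under eq_bigr do rewrite rttv_suffix // ttvS mulr_suml.
have Hk : rk t' k = rk t k by apply: Hr; lia.
rewrite exchange_big /= Hr'' // Hk.
apply: eq_bigr => a _; rewrite mulr_sumr; apply: eq_bigr => c _.
rewrite nth_cat sl ltnn subnn Hc'' // -/(w y c) -mulrA; congr (_ * _).
rewrite -lstep_ttv; apply: eq_ttv => j *; [apply: Hr''; lia|apply: Hc''; lia|].
by rewrite nth_cat sl; case: ifP => //; lia.
Qed.

End Step.

(** * Left-to-right sweeps of orthogonal steps *)

(** Core [s + m] lies outside both the unchanged and the orthogonal ranges: it is not decomposed,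
    but for [m > 0] it absorbs the factor [C] of the last step. *)
Lemma sweep_lstep_fixed ns e s m t t' : sweep (lstep ns e) (iota s m) t t' ->
  [/\ forall j, (j <= size ns)%N -> (j <= s)%N || (s + m < j)%N -> rk t' j = rk t j,
      forall j a i b, (j < size ns)%N -> (j < s)%N || (s + m < j)%N ->
        cr t' j a i b = cr t j a i b &
      (forall j, (j < s)%N -> lorth ns t j) ->
      forall j, (j < s + m)%N -> lorth ns t' j].
Proof.
elim: m s t => [|m IH] s t /= Hs.
  by inversion Hs; subst; split=> // H j; rewrite addn0; apply: H.
inversion Hs as [|k ks t0 t1 t2 [C S] H1]; subst => {Hs}.
case: S => sd [Hr Hc _ [Hl _ _]]; case: (IH _ _ H1) => Hr1 Hc1 Hl1.
split.
- by move=> j jd jr; rewrite Hr1 //; [apply: Hr => //|]; lia.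
- by move=> j a i b jd jr; rewrite Hc1 //; [apply: Hc => //|]; lia.
move=> lo j jm; apply: Hl1; last by rewrite addSnnS.
move=> j' j's; have [->//|ne] := eqVneq j' s.
by apply: lorth_eq (lo j' _); [|apply: Hr|apply: Hr|move=> *; apply: Hc|]; lia.
Qed.

Lemma sweep_lstep_rk1 ns e ks t t' : sweep (lstep ns e) ks t t' ->
  rk t 0 = 1%N -> rk t (size ns) = 1%N ->
  rk t' 0 = 1%N /\ rk t' (size ns) = 1%N.
Proof.
elim=> // k ks' u u1 u2 [C S] _ IH r0 rd.
by apply: IH; [apply: lstep_rk0 S r0|apply: lstep_rkd S rd].
Qed.

Lemma sweep_lstep_exact ns ks t t' ix : sweep (lstep ns 0) ks t t' ->
  rk t 0 = 1%N -> rk t (size ns) = 1%N -> ix \in mindices ns ->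
  tt_eval (size ns) t' ix = tt_eval (size ns) t ix.
Proof.
elim=> // k ks' u u1 u2 [C S] _ IH r0 rd ixn.
rewrite IH ?(lstep_exact S) //; [exact: lstep_rk0 S r0|exact: lstep_rkd S rd].
Qed.

(** Induction with Pythagoras: the first step contributes at most [e], and its error is orthogonal
    to that of the remaining sweep. The orthogonality hypotheses pass to [s.+1] because the step
    makes core [s] left-orthogonal and leaves the cores after [s.+1] alone. *)
Lemma sweep_lstep_err_le ns e s m t t' : sweep (lstep ns e) (iota s m) t t' ->
  rk t 0 = 1%N -> rk t (size ns) = 1%N ->
  (forall j, (j < s)%N -> lorth ns t j) ->
  (forall j, (s < j < size ns)%N -> rorth ns t j) ->
  \sum_(ix <- mindices ns) (tt_eval (size ns) t ix - tt_eval (size ns) t' ix) ^+ 2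
  <= e *+ m.
Proof.
elim: m s t => [|m IH] s t /= Hs r0 rd lo ro.
  by inversion Hs; subst; rewrite big1 // => ix _; rewrite subrr expr0n.
inversion Hs as [|k ks t0 t1 t2 [C S] H1]; subst => {Hs}.
have r0' := lstep_rk0 S r0; have rd' := lstep_rkd S rd.
have [r0'' rd''] := sweep_lstep_rk1 H1 r0' rd'.
have [Hr1 Hc1 Hl1] := sweep_lstep_fixed H1.
have [sd [Hr Hc _ [Hl _ _]]] := S.
set d := size ns in rd rd' rd'' *.
have lo' j : (j < s.+1)%N -> lorth ns t1 j.
  move=> js; have [->//|ne] := eqVneq j s.
  by apply: lorth_eq (lo j _); [|apply: Hr|apply: Hr|move=> *; apply: Hc|]; lia.
have ro' j : (s.+1 < j < d)%N -> rorth ns t1 j.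
  move=> jd; apply: lorth_eq (ro j _); rewrite /= -/d //; last lia.
  - by apply: Hr; lia.
  - by apply: Hr; lia.
  - by move=> a i b; apply: Hc; lia.
(* Both [t1] and the final [t'] keep the new core [s] and everything before it, so the first error
   is orthogonal to each of their tensors, hence to the difference. *)
have D1 : \sum_(ix <- mindices ns)
    (tt_eval d t ix - tt_eval d t1 ix) * tt_eval d t1 ix = 0.
  by apply: (lstep_err_orth S).
have D2 : \sum_(ix <- mindices ns)
    (tt_eval d t ix - tt_eval d t1 ix) * tt_eval d t' ix = 0.
  apply: (lstep_err_orth S) => //.
    by move=> j js; apply: Hr1; lia.
  by move=> j a i b js; apply: Hc1; lia.
have -> : \sum_(ix <- mindices ns) (tt_eval d t ix - tt_eval d t' ix) ^+ 2 =
    \sum_(ix <- mindices ns) (tt_eval d t ix - tt_eval d t1 ix) ^+ 2 +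
    \sum_(ix <- mindices ns) (tt_eval d t1 ix - tt_eval d t' ix) ^+ 2.
  transitivity (\sum_(ix <- mindices ns) (tt_eval d t ix - tt_eval d t1 ix) ^+ 2 +
      \sum_(ix <- mindices ns) (tt_eval d t1 ix - tt_eval d t' ix) ^+ 2 +
    (\sum_(ix <- mindices ns) (tt_eval d t ix - tt_eval d t1 ix) * tt_eval d t1 ix -
     \sum_(ix <- mindices ns) (tt_eval d t ix - tt_eval d t1 ix) * tt_eval d t' ix) *+ 2).
    rewrite -sumrB -sumrMnl -!big_split; apply: eq_bigr => ix _ /=; ring.
  by rewrite D1 D2 subrr mul0rn addr0.
rewrite mulrS lerD //; first exact: (lstep_err_le S).
exact: IH H1 r0' rd' lo' ro'.
Qed.

(** * The concrete steps as orthogonal steps *)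

(** Matrix form of [lstep_by]: an approximation of [M] by [U C] whose residual is orthogonal to the
    columns of [U]. It separates the decomposition used from the unfolding to which it is
    applied. *)
Definition orthofac m n M r U C (e : R) : Prop :=
  [/\ orthocols m r U,
      forall j c, (j < r)%N -> (c < n)%N ->
        \sum_(x < m) U x j * (M x c - \sum_(l < r) U x l * C l c) = 0 &
      \sum_(x < m) \sum_(c < n) (M x c - \sum_(l < r) U x l * C l c) ^+ 2 <= e].

Lemma orthofac_exact m n M r U C : orthocols m r U ->
  (forall x c, (x < m)%N -> (c < n)%N -> M x c = \sum_(l < r) U x l * C l c) ->
  orthofac m n M r U C 0.
Proof.
move=> oU ME; split=> // [j c jr cn|].
  by rewrite big1 // => x _; rewrite ME // subrr mulr0.
by rewrite big1 // => x _; rewrite big1 // => c _; rewrite ME // subrr expr0n.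
Qed.

(** The residual is the tail of the SVD. It involves only columns of [U] from [r] on, and
    orthonormality of [U] and [V] makes its squared norm the sum of the discarded squared singular
    values. *)
Lemma orthofac_svd delta m n M r U s V : trunc_svd delta m n M r U s V ->
  orthofac m n M r U (fun a l => s a * V l a) (delta ^+ 2).
Proof.
case=> [[oU oV _ _ ME] [rq [tl _]]]; set q := minn m n in oU oV ME rq tl *.
(* Singular values with the kept ones set to 0, so that the residual is a sum over all [q] columns
   and [parseval] applies to it. *)
pose g l := (r <= l)%:R * s l.
have EE x c : (x < m)%N -> (c < n)%N ->
    M x c - \sum_(l < r) U x l * (s l * V c l) =
    \sum_(l < q) U x l * (g l * V c l).
  move=> xm cn; rewrite ME // (big_ord_widen_cond q xpredT (fun l => U x l * (s l * V c l))) //.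
  rewrite [X in _ - X]big_mkcond -sumrB; apply: eq_bigr => l _ /=.
  by rewrite /g; case: (leqP r l) => _ /=; rewrite ?mul1r ?mul0r; ring.
split.
- move=> j1 j2 h1 h2; apply: oU; exact: leq_trans rq.
- move=> j c jr cn; under eq_bigr do rewrite EE //.
  have jq := leq_trans jr rq.
  transitivity (\sum_(l < q) (j == l)%:R * (g l * V c l)).
    under eq_bigr do rewrite mulr_sumr.
    rewrite exchange_big; apply: eq_bigr => l _ /=.
    by rewrite -oU // mulr_suml; apply: eq_bigr => x _; rewrite mulrA.
  by rewrite (sum_delta (fun l => g l * V c l)) // /g leqNgt jr /= !mul0r.
apply: le_trans tl; rewrite exchange_big /= /tail_sq big_geq_mkord.
apply: ler_of_eq.
transitivity (\sum_(c < n) \sum_(l < q) (g l * V c l) * (g l * V c l)).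
  apply: eq_bigr => c _.
  rewrite -(parseval (fun l => g l * V c l) (fun l => g l * V c l)
    (oU : orthon (index_enum _) q (fun x : 'I_m => U x))).
  by apply: eq_bigr => x _; rewrite EE // expr2.
rewrite exchange_big [RHS]big_mkcond; apply: eq_bigr => l _ /=.
transitivity (g l ^+ 2 * \sum_(c < n) V c l * V c l).
  by rewrite mulr_sumr; apply: eq_bigr => c _; ring.
by rewrite oV // eqxx mulr1 /g; case: leqP => _; rewrite ?mul1r ?mul0r ?expr0n.
Qed.

Lemma big_ord_mul a n (F : nat -> R) :
  \sum_(x < a * n) F x = \sum_(i < a) \sum_(j < n) F (i * n + j)%N.
Proof.
elim: a F => [|a IH] F; first by rewrite mul0n !big_ord0.
rewrite mulSn big_split_ord big_ord_recl; congr (_ + _).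
rewrite (IH (fun x => F (n + x)%N)); apply: eq_bigr => i _; apply: eq_bigr => j _.
by congr F; rewrite /= /bump /=; lia.
Qed.

Lemma divn_pair a n i : (i < n)%N -> ((a * n + i) %/ n)%N = a.
Proof. by move=> lt; rewrite divnMDl ?divn_small ?addn0 //; lia. Qed.

Lemma modn_pair a n i : (i < n)%N -> ((a * n + i) %% n)%N = i.
Proof. by move=> lt; rewrite modnMDl modn_small. Qed.

Lemma lstep_left ns t k r U C e : (k.+1 < size ns)%N ->
  orthofac (rk t k * ns_at ns k) (rk t k.+1) (Lunf (ns_at ns k) (cr t k)) r U C e ->
  lstep_by ns e t
    (MkTT (upd (rk t) k.+1 r)
          (upd (upd (cr t) k (core_of_L (ns_at ns k) U))
               k.+1 (lmul_slices (rk t k.+1) C (cr t k.+1)))) k C.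
Proof.
set n := ns_at ns k => kd [oU oE eE]; split=> //.
have neS : (k == k.+1) = false by apply/eqP; lia.
have EE (a : nat) i b : (i < n)%N -> err t (MkTT (upd (rk t) k.+1 r)
          (upd (upd (cr t) k (core_of_L n U))
               k.+1 (lmul_slices (rk t k.+1) C (cr t k.+1)))) k C a i b =
     Lunf n (cr t k) (a * n + i) b - \sum_(l < r) U (a * n + i)%N l * C l b.
  by move=> lt; rewrite /err /= /upd !eqxx neS /core_of_L /Lunf divn_pair // modn_pair.
split; first by move=> j _ /negbTE jk; rewrite /= /upd jk.
- by move=> j a i b _ /negbTE h1 /negbTE h2; rewrite /= /upd h1 h2.
- by move=> a i b; rewrite /= /upd eqxx.
split.
- move=> b b'; rewrite /= /upd eqxx neS => hb hb'.
  by rewrite -(oU b b') // (big_ord_mul _ _ (fun x => U x b * U x b')) /= eqxx.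
- move=> c b; rewrite /= {1}/upd eqxx => hc hb.
  rewrite -[RHS](oE c b) // (big_ord_mul _ _ (fun x => U x c *
    (Lunf n (cr t k) x b - \sum_(l < r) U x l * C l b))).
  apply: eq_bigr => a _; apply: eq_bigr => i _.
  by rewrite EE // /upd neS eqxx.
apply: le_trans eE; rewrite (big_ord_mul _ _ (fun x =>
  \sum_(c < rk t k.+1) (Lunf n (cr t k) x c - \sum_(l < r) U x l * C l c) ^+ 2)); apply: ler_of_eq.
by apply: eq_bigr => a _; apply: eq_bigr => i _; apply: eq_bigr => b _; rewrite EE.
Qed.

(** A row of the transposed right unfolding encodes [(i, l)], whereas the reversed core reads
    [(l, i)]; hence the exchanges of sums. [Ct] is separate from [C] because the steps write the
    transposed factor in forms that agree only pointwise. *)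
Lemma lstep_right ns t k r U C Ct e : (0 < k < size ns)%N ->
  (forall l b, Ct l b = C b l) ->
  orthofac (ns_at ns k * rk t k.+1) (rk t k) (trm (Runf (rk t k.+1) (cr t k))) r U C e ->
  lstep_by (rev ns) e (revT (size ns) t)
    (revT (size ns)
    (MkTT (upd (rk t) k r)
          (upd (upd (cr t) k (core_of_R (rk t k.+1) (trm U)))
               k.-1 (rmul_slices (rk t k) (cr t k.-1) Ct))))
    ((size ns).-1 - k) C.
Proof.
set d := size ns; set n := ns_at ns k; set m := rk t k.+1.
set t' := MkTT _ _ => kd CtE [oU oE eE].
have E1 : (d - (d.-1 - k))%N = k.+1 by lia.
have E2 : (d.-1 - (d.-1 - k))%N = k by lia.
have E3 : (d - (d.-1 - k).+1)%N = k by lia.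
have E4 : (d.-1 - (d.-1 - k).+1)%N = k.-1 by lia.
have nE : ns_at (rev ns) (d.-1 - k) = n.
  by rewrite /ns_at nth_rev -/d; [congr nth; lia|lia].
have neP : (k == k.-1) = false by apply/eqP; lia.
have neS : (k.+1 == k) = false by apply/eqP; lia.
have EE (l : nat) i b : (l < m)%N -> err (revT d t) (revT d t') (d.-1 - k) C l i b =
     trm (Runf m (cr t k)) (i * m + l) b - \sum_(c < r) U (i * m + l)%N c * C c b.
  move=> lt; rewrite /err /= E2 E3 /upd !eqxx neP /core_of_R /trm /Runf.
  by rewrite divn_pair // modn_pair.
split; first by rewrite size_rev -/d; lia.
rewrite size_rev -/d; split.
- by move=> j jd jk; rewrite /= /upd; case: eqP => // ?; lia.
- by move=> j a i b jd h1 h2; rewrite /= /upd; do 2![case: eqP => [?|_]; first by lia].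
- move=> a i b; rewrite /= E3 E4 /upd eqxx /rmul_slices.
  by apply: eq_bigr => l _; rewrite CtE mulrC.
split.
- move=> b b'; rewrite /= E1 E2 E3 nE /upd !eqxx neS => hb hb'.
  rewrite -(oU b b') // (big_ord_mul _ _ (fun x => U x b * U x b')) exchange_big.
  by apply: eq_bigr => i _; apply: eq_bigr => l _; rewrite neP.
- move=> c b; rewrite [rk _ _]/= [X in (b < X)%N -> _]/= E3 {1}/upd eqxx => hc hb.
  rewrite -[RHS](oE c b) // (big_ord_mul _ _ (fun x => U x c *
    (trm (Runf m (cr t k)) x b - \sum_(l < r) U x l * C l b))) nE [RHS]exchange_big /= E1.
  apply: eq_bigr => l _; apply: eq_bigr => i _.
  by rewrite EE // E2 /upd eqxx neP.
apply: le_trans eE; rewrite (big_ord_mul _ _ (fun x =>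
  \sum_(c < rk t k) (trm (Runf m (cr t k)) x c - \sum_(l < r) U x l * C l c) ^+ 2)).
rewrite exchange_big nE /= E1 E3; apply: ler_of_eq.
by apply: eq_bigr => i _; apply: eq_bigr => l _; apply: eq_bigr => b _; rewrite EE.
Qed.

(** * Depar on unfoldings whose columns are standard basis vectors *)

Definition unitcols m n M := forall c, (c < n)%N -> exists2 x0, (x0 < m)%N &
  forall x, (x < m)%N -> M x c = (x == x0)%:R.

(** Row [f] decides: the left side is 1 there, so [f <> g] would give 1 = 0, and [f = g] gives
    [c = 1]. Thus [depar] can only merge equal columns. *)
Lemma unit_scal_col m M N i j c g f : (g < m)%N -> (f < m)%N ->
  (forall x, (x < m)%N -> M x j = (x == f)%:R) ->
  (forall x, (x < m)%N -> N x i = (x == g)%:R) ->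
  scal_col m M j N i c -> f = g /\ c = 1.
Proof.
move=> gm fm ME NE /(_ f fm); rewrite ME // NE // eqxx; case: eqP => [->|_] /=.
  by rewrite mulr1.
by rewrite mulr0 => /eqP; rewrite oner_eq0.
Qed.

Lemma depar_unit m n M beta N T : depar m n M beta N T -> unitcols m n M ->
  orthofac m n M beta N T 0 /\
  (forall c, (c < n)%N -> exists2 l0, (l0 < beta)%N &
     forall l, T l c = (l == l0)%:R).
Proof.
move=> run uM.
(* Invariant of the run: the kept columns are basis vectors at distinct rows [g i], every processed
   column equals a kept one recorded by a unit column of [T], and the columns of [T] still to come
   are 0, so that [set_entry] produces exactly a unit column. *)
have [] : [/\ (exists g : nat -> nat,
    [/\ forall i, (i < beta)%N -> (g i < m)%N,
        forall i x, (i < beta)%N -> (x < m)%N -> N x i = (x == g i)%:R &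
        forall i i', (i < beta)%N -> (i' < beta)%N -> g i = g i' -> i = i']),
    (forall c, (c < n)%N -> exists l0, [/\ (l0 < beta)%N,
       forall x, (x < m)%N -> M x c = N x l0 & forall l, T l c = (l == l0)%:R]) &
    (forall l c, (n <= c)%N -> T l c = 0)]; last first.
  move=> [g [gm NE gI]] TE _.
  split; last by move=> c /TE[l0 [? _ ?]]; exists l0.
  apply: orthofac_exact => [i i' hi hi'|x c xm cn].
    rewrite -[RHS](_ : (g i == g i')%:R = _); last first.
      by congr (nat_of_bool _)%:R; apply/eqP/eqP => [/gI->|->].
    under eq_bigr do rewrite !NE // eq_sym.
    exact: (sum_delta (fun x => (x == g i')%:R) (gm i hi)).
  have [l0 [lb ME Tl]] := TE c cn; rewrite ME //.
  rewrite -[LHS](sum_delta (fun l => N x l) lb); apply: eq_bigr => l _.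
  by rewrite Tl mulrC eq_sym.
elim: run uM => {n beta N T} [|j beta N T i c run IH ib sc _|j beta N T run IH new] uM.
- by split=> //; exists id.
- have [|[g [gm NE gI]] TE T0] := IH; first by move=> c' h; apply: uM; apply: ltnW.
  have [f fm ME] := uM j (ltnSn j).
  have [fg c1] := unit_scal_col (gm i ib) fm ME (fun x => NE i x ib) sc.
  split; first by exists g.
    move=> c'; rewrite ltnS leq_eqVlt => /predU1P [->|lt].
      exists i; split=> // [x xm|l]; first by rewrite sc // c1 mul1r.
      by rewrite /set_entry eqxx andbT c1; case: eqP => // _; rewrite T0.
    have [l0 [? ? Tl]] := TE c' lt; exists l0; split=> // l.
    by rewrite /set_entry (ltn_eqF lt) andbF Tl.
  move=> l c' lt; rewrite /set_entry (gtn_eqF lt) andbF T0 //; exact: ltnW.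
have [|[g [gm NE gI]] TE T0] := IH; first by move=> c' h; apply: uM; apply: ltnW.
have [f fm ME] := uM j (ltnSn j).
(* A column whose row is already taken would be a kept column times 1, against [new]; this keeps [g]
   injective after the extension by [f]. *)
have fNg i : (i < beta)%N -> g i <> f.
  move=> ib gf; case: (new i ib); exists 1 => x xm.
  by rewrite ME // NE // gf mul1r.
split.
- exists (upd g beta f); rewrite /upd /set_col; split.
  + by move=> i; rewrite ltnS leq_eqVlt; case: eqP => //= _; apply: gm.
  + move=> i x; rewrite ltnS leq_eqVlt; case: eqP => //= _ ? ?; [exact: ME|exact: NE].
  + move=> i i'; rewrite ltnS leq_eqVlt => hi; rewrite ltnS leq_eqVlt => hi'.
    move: hi hi'; do 2![case: eqP => /= [->|_]] => // hi hi'.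
    * by move/esym/(fNg _ hi').
    * by move/(fNg _ hi).
    * exact: gI.
- move=> c'; rewrite ltnS leq_eqVlt => /predU1P [->|lt].
    exists beta; split=> // [x xm|l]; first by rewrite /set_col eqxx.
    by rewrite /set_entry eqxx andbT; case: eqP => // _; rewrite T0.
  have [l0 [lb ? Tl]] := TE c' lt; exists l0; split=> [|x xm|l].
  + exact: ltnW.
  + by rewrite /set_col (ltn_eqF lb); auto.
  + by rewrite /set_entry (ltn_eqF lt) andbF Tl.
- move=> l c' lt; rewrite /set_entry (gtn_eqF lt) andbF T0 //; exact: ltnW.
Qed.

Definition unitcore ns t k := forall b, (b < rk t k.+1)%N -> exists a0 i0,
  [/\ (a0 < rk t k)%N, (i0 < ns_at ns k)%N &
   forall a i, (a < rk t k)%N -> (i < ns_at ns k)%N ->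
     cr t k a i b = ((a == a0) && (i == i0))%:R].

(* The selection cores [delta_ab [i = i_k^(b)]] of the initial TT at the modes
   strictly between the first, the last and the [p]-th one. *)
Definition diagcore ns t k := rk t k = rk t k.+1 /\
  forall b, (b < rk t k.+1)%N -> exists2 i0, (i0 < ns_at ns k)%N &
   forall a i, (a < rk t k)%N -> (i < ns_at ns k)%N ->
     cr t k a i b = ((a == b) && (i == i0))%:R.

Lemma unitcore_eq ns ns' t t' k k' :
  ns_at ns' k' = ns_at ns k ->
  rk t' k' = rk t k -> rk t' k'.+1 = rk t k.+1 ->
  (forall a i b, cr t' k' a i b = cr t k a i b) -> unitcore ns t k -> unitcore ns' t' k'.
Proof.
move=> Hn Hr Hr1 Hc H b; rewrite Hr1 Hr Hn => /H [a0 [i0 [ha hi Hb]]].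
by exists a0, i0; split=> // a i; rewrite Hc; apply: Hb.
Qed.

Lemma diagcore_eq ns ns' t t' k k' :
  ns_at ns' k' = ns_at ns k ->
  rk t' k' = rk t k -> rk t' k'.+1 = rk t k.+1 ->
  (forall a i b, cr t' k' a i b = cr t k a i b) -> diagcore ns t k -> diagcore ns' t' k'.
Proof.
move=> Hn Hr Hr1 Hc [He H]; split; first by rewrite Hr Hr1.
move=> b; rewrite Hr1 Hr Hn => /H [i0 hi Hb].
by exists i0 => // a i; rewrite Hc; apply: Hb.
Qed.

Lemma eq_pair x n a i : (i < n)%N -> (x == a * n + i)%N = (x %/ n == a)%N && (x %% n == i)%N.
Proof.
move=> lt; apply/eqP/andP => [->|[/eqP <- /eqP <-]]; last exact: divn_eq.
by rewrite divn_pair // modn_pair.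
Qed.

Lemma ltn_pair m n a i : (a < m)%N -> (i < n)%N -> (a * n + i < m * n)%N.
Proof. nia. Qed.

Lemma unitcore_Lunf ns t k : unitcore ns t k ->
  unitcols (rk t k * ns_at ns k) (rk t k.+1) (Lunf (ns_at ns k) (cr t k)).
Proof.
move=> H b /H [a0 [i0 [ha hi Hb]]]; exists (a0 * ns_at ns k + i0)%N.
  exact: ltn_pair.
move=> x lt; have n0 : (0 < ns_at ns k)%N by case: ns_at lt hi.
by rewrite /Lunf eq_pair // Hb ?ltn_divLR ?ltn_mod.
Qed.

Lemma ns_at_rev ns k : (k < size ns)%N ->
  ns_at (rev ns) ((size ns).-1 - k) = ns_at ns k.
Proof. by move=> kd; rewrite /ns_at nth_rev; [congr nth; lia|lia]. Qed.

Lemma unitcore_Runf ns t k : (k < size ns)%N ->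
  unitcore (rev ns) (revT (size ns) t) ((size ns).-1 - k) ->
  unitcols (ns_at ns k * rk t k.+1) (rk t k) (trm (Runf (rk t k.+1) (cr t k))).
Proof.
move=> kd; rewrite /unitcore ns_at_rev //=.
rewrite (_ : size ns - ((size ns).-1 - k) = k.+1)%N; last by lia.
rewrite (_ : size ns - ((size ns).-1 - k).+1 = k)%N; last by lia.
rewrite (_ : (size ns).-1 - ((size ns).-1 - k) = k)%N; last by lia.
move=> H b /H [a0 [i0 [ha hi Hb]]]; exists (i0 * rk t k.+1 + a0)%N.
  exact: ltn_pair.
move=> x lt; have n0 : (0 < rk t k.+1)%N by case: (rk t k.+1) lt ha.
by rewrite /trm /Runf eq_pair // andbC Hb ?ltn_divLR ?ltn_mod.
Qed.

(** A Depar step as an exact orthogonal step. The unit columns of [C] are recorded because they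
    carry the unit property to the next core. *)
Definition conv_step ns t t' k : Prop := unitcore ns t k ->
  exists C, lstep_by ns 0 t t' k C /\
    forall b, (b < rk t k.+1)%N -> exists2 l0, (l0 < rk t' k.+1)%N &
      forall l, C l b = (l == l0)%:R.

Lemma conv_step_left ns t t' k : (k.+1 < size ns)%N ->
  conv_left ns t t' k -> conv_step ns t t' k.
Proof.
move=> kd [beta [N [T [dp ->]]]] /unitcore_Lunf /(depar_unit dp) [fac TE].
by exists T; split; [exact: lstep_left|rewrite /= /upd eqxx].
Qed.

Lemma conv_step_right ns t t' k : (0 < k < size ns)%N ->
  conv_right ns t t' k ->
  conv_step (rev ns) (revT (size ns) t) (revT (size ns) t') ((size ns).-1 - k).
Proof.
move=> kd [beta [N [T [dp ->]]]] uc; have [_ kn] := andP kd.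
have [fac TE] := depar_unit dp (unitcore_Runf kn uc).
exists T; split; first exact: lstep_right.
rewrite /= (_ : size ns - ((size ns).-1 - k).+1 = k)%N; last by lia.
by rewrite /upd eqxx.
Qed.

Lemma svd_step_left ns delta t t' k : (k.+1 < size ns)%N ->
  round_svd1 ns delta t t' k -> lstep ns (delta ^+ 2) t t' k.
Proof.
move=> kd [r [U [s [V [/orthofac_svd fac ->]]]]].
by exists (fun a l => s a * V l a); apply: lstep_left.
Qed.

Lemma svd_step_right ns delta t t' k : (0 < k < size ns)%N ->
  round_svd2 ns delta t t' k ->
  lstep (rev ns) (delta ^+ 2) (revT (size ns) t) (revT (size ns) t') ((size ns).-1 - k).
Proof.
move=> kd [r [U [s [V [/orthofac_svd fac ->]]]]].
exists (fun a l => s a * V l a); apply: lstep_right => // l b; exact: mulrC.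
Qed.

Lemma qr_step_right ns t t' k : (0 < k < size ns)%N ->
  round_qr ns t t' k ->
  lstep (rev ns) 0 (revT (size ns) t) (revT (size ns) t') ((size ns).-1 - k).
Proof.
move=> kd [Q [Rm [[oQ _ ME] ->]]].
by exists Rm; apply: lstep_right => //; apply: orthofac_exact.
Qed.

(** Used with [f] the reversal and [g] the map [k] to [d.-1 - k] for right-to-left sweeps, and with
    identities to replace a concrete step by its abstract form. *)
Lemma sweep_map (S1 S2 : TT R -> TT R -> nat -> Prop) f g ks t t' :
  (forall u u' k, k \in ks -> S1 u u' k -> S2 (f u) (f u') (g k)) ->
  sweep S1 ks t t' -> sweep S2 (map g ks) (f t) (f t').
Proof.
move=> H sw; elim: sw H => [u|k ks' u u1 u2 S _ IH] H /=; first exact: sweep_nil.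
apply: sweep_cons (IH _); first by apply: H S; rewrite mem_head.
by move=> v v' k' k's; apply: H; rewrite inE k's orbT.
Qed.

Lemma map_rev_iota d s m : (s + m <= d)%N ->
  map (fun k => d.-1 - k)%N (rev (iota s m)) = iota (d - (s + m)) m.
Proof.
move=> smd; apply: (@eq_from_nth _ 0%N) => [|i].
  by rewrite size_map size_rev !size_iota.
rewrite size_map size_rev size_iota => im.
rewrite (nth_map 0%N) ?size_rev ?size_iota // nth_rev size_iota // !nth_iota //; lia.
Qed.

(** Each step needs unit columns in the core it meets. They are regenerated on the way, since
    multiplying a diagonal selection core by a factor with unit columns gives a core with unit
    columns. *)
Lemma conv_sweep ns s m t t' : (s + m < size ns)%N ->
  sweep (conv_step ns) (iota s m) t t' ->
  ((0 < m)%N -> unitcore ns t s) ->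
  (forall j, (s < j < s + m)%N -> diagcore ns t j) ->
  sweep (lstep ns 0) (iota s m) t t'.
Proof.
elim: m s t => [|m IH] s t /= smd sw uc dc.
  by inversion sw; subst; apply: sweep_nil.
inversion sw as [|k ks t0 t1 t2 S1 sw1]; subst => {sw}.
have [C [S CE]] := S1 (uc isT).
apply: sweep_cons (IH _ _ _ sw1 _ _); first by exists C.
- by rewrite addSnnS.
- move=> m0; have [sd [Hr _ HC _]] := S.
  have [Hd Hu] : diagcore ns t s.+1 by apply: dc; lia.
  have r2 : rk t1 s.+2 = rk t s.+2 by apply: Hr; lia.
  move=> b; rewrite r2 => hb; have [i0 hi Hb] := Hu b hb.
  have [|l0 hl Cl] := CE b; first by rewrite Hd.
  exists l0, i0; split=> // a i ha hin; rewrite HC.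
  have hb' : (b < rk t s.+1)%N by rewrite Hd.
  (* The diagonal core selects [l = b], leaving column [b] of [C], a unit vector at [l0]. *)
  transitivity (\sum_(l < rk t s.+1) (b == l)%:R * (C a l * (i == i0)%:R)).
    apply: eq_bigr => l _; rewrite Hb // eq_sym.
    by case: (b == l :> nat); rewrite ?mul0r ?mulr0 ?mul1r.
  by rewrite (sum_delta (fun l => C a l * (i == i0)%:R)) // Cl -natrM mulnb.
move=> j js; have [sd [Hr Hc _ _]] := S.
apply: diagcore_eq (dc j _); [by []|apply: Hr|apply: Hr|move=> *; apply: Hc|]; lia.
Qed.

(** * The initial TT *)

(** Reversal swaps the two rank indices, and a diagonal pattern is symmetric in them. *)
Lemma diagcore_rev ns t k : (k < size ns)%N ->
  diagcore ns t ((size ns).-1 - k) -> diagcore (rev ns) (revT (size ns) t) k.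
Proof.
move=> kd; set j := ((size ns).-1 - k)%N => -[H1 H2].
have e1 : (size ns - k = j.+1)%N by lia.
have e2 : (size ns - k.+1 = j)%N by lia.
have nE : ns_at (rev ns) k = ns_at ns j by rewrite /ns_at nth_rev // e2.
rewrite /diagcore nE /= e1 e2 H1; split=> // b hb.
have [i0 hi Hb] := H2 b hb; exists i0 => // a i ha hin.
have [<-|ne] := eqVneq b a; first by rewrite Hb ?H1 // eqxx.
have [i1 _ Ha] := H2 a ha; rewrite Ha ?H1 //.
by rewrite (negbTE ne).
Qed.

Section Init.
Variables (ns : seq nat) (p0 : nat) (A : seq nat -> R) (fib : seq (seq nat)).
Let d := size ns.
Hypotheses (d2 : (2 <= d)%N) (p0d : (p0 < d)%N) (fibE : fiber_enum ns p0 A fib).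
Let t0 := init_tt d p0 A fib.

Lemma fib_mindices b : (b < size fib)%N ->
  nth [::] fib b \in mindices (set_nth 0%N ns p0 1%N).
Proof. by move=> hb; case: fibE => _ H; case/(H _): (mem_nth [::] hb). Qed.

Lemma fib_size b : (b < size fib)%N -> size (nth [::] fib b) = d.
Proof.
move=> /fib_mindices /mindicesP [-> _]; rewrite size_set_nth; exact/maxn_idPr.
Qed.

Lemma fib_lt b k : (b < size fib)%N -> (k < d)%N -> k != p0 ->
  (nth 0%N (nth [::] fib b) k < ns_at ns k)%N.
Proof.
move=> /fib_mindices /mindicesP [_ lt] kd /negbTE kp.
have := lt k; rewrite size_set_nth (maxn_idPr _) // nth_set_nth /= kp.
exact.
Qed.

Lemma fib_p0 b : (b < size fib)%N -> nth 0%N (nth [::] fib b) p0 = 0%N.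
Proof.
move=> /fib_mindices /mindicesP [_ lt].
have := lt p0; rewrite size_set_nth (maxn_idPr _) // nth_set_nth /= eqxx => /(_ p0d).
by rewrite ltnS leqn0 => /eqP.
Qed.

Lemma init_rk k : (0 < k < d)%N -> rk t0 k = size fib.
Proof. by move=> kd; rewrite /= (_ : (k == 0%N) || (k == d) = false) //; lia. Qed.

Lemma init_diagcore k : (0 < k)%N -> (k.+1 < d)%N -> k != p0 -> diagcore ns t0 k.
Proof.
move=> k0 kd kp; rewrite /diagcore !init_rk; [split=> // b hb|lia|lia].
exists (nth 0%N (nth [::] fib b) k); first by apply: fib_lt => //; lia.
move=> a i _ _ /=.
have [k0' kd'] : (k == 0%N) = false /\ (k == d.-1) = false by split; lia.
rewrite k0' kd' /=.
by case: eqP => [->|] //; rewrite (negbTE kp).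
Qed.

Lemma init_unitcore : (0 < p0)%N -> unitcore ns t0 0.
Proof.
have r1 : rk t0 1 = size fib by apply: init_rk; lia.
move=> p00 b; rewrite r1 => hb; exists 0%N, (nth 0%N (nth [::] fib b) 0); split=> //.
  by apply: fib_lt => //; lia.
move=> a i; rewrite [rk _ _]/= => a1 _; have -> : a = 0%N by lia.
rewrite /=.
by rewrite (_ : 0%N == p0 = false) //; lia.
Qed.

Lemma init_unitcore_rev : (p0 < d.-1)%N -> unitcore (rev ns) (revT d t0) 0.
Proof.
move=> pd b; rewrite [rk (revT _ _) _]/= -/(rk t0 _) => hb0.
have hb : (b < size fib)%N by move: hb0; rewrite (_ : _ || _ = false) //; lia.
exists 0%N, (nth 0%N (nth [::] fib b) d.-1); split=> //.
- by rewrite /= subn0 eqxx orbT.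
- rewrite -{2}(subnn d.-1) ns_at_rev -/d; last lia.
  by apply: fib_lt => //; lia.
move=> a i; rewrite /= !subn0 eqxx !orbT => a1 _; have -> : a = 0%N by lia.
rewrite /=.
have [e1 e2] : (d.-1 == 0%N) = false /\ (d.-1 == p0) = false by split; lia.
by rewrite e1 e2 eqxx.
Qed.

(** The factor contributed by core [k] to the [j]-th fiber: the fiber value at mode [p0], elsewhere
    the test that [ix] has the fixed index of that fiber. *)
Let fac ix k j := if k == p0 then A (set_nth 0%N (nth [::] fib j) p0 (nth 0%N ix p0))
  else (nth 0%N ix k == nth 0%N (nth [::] fib j) k)%:R.

(** The interior cores are diagonal in the rank index, so the chains of different fibers never mix.
    They are summed only at the last core, hence [k < d]. *)
Lemma init_ttv ix k j : (0 < k < d)%N -> (j < size fib)%N ->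
  ttv t0 ix k j = \prod_(k' < k) fac ix k' j.
Proof.
case: k => // k; elim: k j => [|k IH] j kd hj.
  rewrite ttvS big_ord1 /= big_ord1 mul1r /fac; by case: eqP => // <-.
have rk1 : rk t0 k.+1 = size fib by apply: init_rk; lia.
rewrite ttvS rk1 [RHS]big_ord_recr [RHS]/= -IH //; last by lia.
rewrite -(sum_delta (fun a => ttv t0 ix k.+1 a * fac ix k.+1 a) hj).
apply: eq_bigr => a _; move: (ttv t0 ix k.+1 a) => X /=.
rewrite (_ : k.+1 == d.-1 = false) /=; last by lia.
case: (eqVneq j a) => _; last by rewrite mul0r mulr0.
by rewrite mul1r /fac; case: eqP => // <-.
Qed.

Lemma init_tt_eval ix : ix \in mindices ns -> tt_eval d t0 ix = A ix.
Proof.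
case/mindicesP; rewrite -/d => sz lt; rewrite /tt_eval.
have dE : d = d.-1.+1 by lia.
transitivity (\sum_(j < size fib) \prod_(k < d) fac ix k j).
  have rd1 : rk t0 d.-1 = size fib by apply: init_rk; lia.
  rewrite {1}dE ttvS rd1.
  apply: eq_bigr => j _; rewrite [in RHS]dE big_ord_recr /= init_ttv //; last by lia.
  congr (_ * _); rewrite eqxx orbT /= (_ : d.-1 == 0%N = false); last by lia.
  by rewrite /fac; case: eqP => // <-.
(* The label that the fiber through [ix] has in [fib], with the placeholder 0 at mode [p0]; only
   this fiber can contribute. *)
pose z := set_nth 0%N ix p0 0%N.
have sz_z : size z = d by rewrite size_set_nth sz; apply/maxn_idPr.
have Az : set_nth 0%N z p0 (nth 0%N ix p0) = ix.
  apply: (@eq_from_nth _ 0%N) => [|k _].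
    by rewrite size_set_nth sz_z sz; apply/maxn_idPr.
  by rewrite !nth_set_nth /= nth_set_nth /=; case: eqP => [->|].
transitivity (\sum_(x <- fib) (x == z)%:R * A ix).
  rewrite (big_nth [::]) big_mkord; apply: eq_bigr => j _.
  case: eqP => [jz|jz].
    rewrite mul1r (bigD1 (Ordinal p0d)) //= {1}/fac eqxx jz Az big1 ?mulr1 // => k.
    rewrite -val_eqE /= /fac => /negbTE kp.
    by rewrite kp jz nth_set_nth /= kp eqxx.
  have [/forallP H|] := boolP [forall k : 'I_d, nth 0%N (nth [::] fib j) k == nth 0%N z k].
    case: jz; apply: (@eq_from_nth _ 0%N); rewrite fib_size // => k kd.
    exact/eqP/(H (Ordinal kd)).
  (* A differing mode [k] cannot be [p0], where both labels hold 0, so its factor is a failed test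
     and the product vanishes. *)
  rewrite negb_forall => /existsP [k kne]; rewrite mul0r (bigD1 k) //= /fac.
  have kp : (k == p0 :> nat) = false.
    by apply: contraNF kne => /eqP ->; rewrite fib_p0 // nth_set_nth /= eqxx.
  rewrite kp; move: kne; rewrite nth_set_nth /= kp eq_sym => /negbTE ->.
  by rewrite mul0r.
have [zin|zout] := boolP (z \in fib).
  rewrite (bigD1_seq z) //=; last by case: fibE.
  by rewrite eqxx mul1r big1 ?addr0 // => x /negbTE ->; rewrite mul0r.
rewrite big_seq big1; last first.
  by move=> x xin; rewrite (_ : x == z = false) ?mul0r //; apply: contraNF zout => /eqP <-.
(* When [z] is not listed the sum is 0, and so is [A ix]: a nonzero entry would put its fiber in
   [fib]. *)
apply/esym/eqP; apply: contraNT zout => Aix; case: fibE => _ H; apply/H; split.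
  apply/mindicesP; rewrite size_set_nth (maxn_idPr _) //; split=> // k kd.
  by rewrite !nth_set_nth /=; case: eqP => // _; apply: lt.
by exists (nth 0%N ix p0); rewrite Az; split=> //; apply: lt.
Qed.
End Init.

(** * Error bound *)

(** The triangle inequality in squared form. If [a] or [b] is 0, the corresponding family vanishes;
    otherwise a weighted Young inequality is summed. *)
Lemma sum_sqrD_le (I : eqType) (r : seq I) (u v : I -> R) (a b : R) :
  0 <= a -> 0 <= b -> \sum_(x <- r) u x ^+ 2 <= a ^+ 2 ->
  \sum_(x <- r) v x ^+ 2 <= b ^+ 2 ->
  \sum_(x <- r) (u x + v x) ^+ 2 <= (a + b) ^+ 2.
Proof.
have zero (w : I -> R) : \sum_(x <- r) w x ^+ 2 <= 0 ^+ 2 ->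
    forall x, x \in r -> w x = 0.
  move=> le0 x xr; apply/eqP; rewrite -sqrf_eq0.
  have := le0; rewrite expr0n le_eqVlt ltNge sumr_ge0 ?orbF; last by move=> *; apply: sqr_ge0.
  by rewrite psumr_eq0 => [/allP/(_ _ xr)|*]; last exact: sqr_ge0.
move=> a0 b0 ua vb; have [az|an0] := eqVneq a 0.
  move: ua; rewrite az => /zero u0.
  rewrite add0r big_seq (eq_bigr (fun x => v x ^+ 2)) -?big_seq // => x xr.
  by rewrite u0 // add0r.
have [bz|bn0] := eqVneq b 0.
  move: vb; rewrite bz => /zero v0.
  rewrite addr0 big_seq (eq_bigr (fun x => u x ^+ 2)) -?big_seq // => x xr.
  by rewrite v0 // addr0.
(* With these weights the bounds [a ^+ 2] and [b ^+ 2] give exactly [(a + b) ^+ 2], and the termwise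
   gap is a perfect square divided by [a * b]. *)
apply: (@le_trans _ _ ((1 + b / a) * \sum_(x <- r) u x ^+ 2 +
                       (1 + a / b) * \sum_(x <- r) v x ^+ 2)).
  rewrite !mulr_sumr -big_split; apply: ler_sum => x _ /=.
  rewrite -subr_ge0 [X in 0 <= X](_ : _ = (b * u x - a * v x) ^+ 2 / (a * b)).
    by rewrite divr_ge0 ?sqr_ge0 // mulr_ge0.
  by field; rewrite bn0 an0.
have -> : (a + b) ^+ 2 = (1 + b / a) * a ^+ 2 + (1 + a / b) * b ^+ 2.
  by field; rewrite bn0 an0.
by rewrite lerD // ler_wpM2l // addr_ge0 // divr_ge0.
Qed.

(** * Right-to-left sweeps through the reversed TT *)

Section RightSweep.
Variables (ns : seq nat) (e : R) (s m : nat) (t t' : TT R).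
Let d := size ns.
Hypotheses (sw : sweep (lstep (rev ns) e) (iota s m) (revT d t) (revT d t'))
  (smd : (s + m < d)%N) (r0 : rk t 0 = 1%N) (rd : rk t d = 1%N).

Let r0' : rk (revT d t) 0 = 1%N. Proof. by rewrite /= subn0. Qed.
Let rd' : rk (revT d t) (size (rev ns)) = 1%N.
Proof. by rewrite size_rev /= subnn. Qed.

Lemma rsweep_rk1 : rk t' 0 = 1%N /\ rk t' d = 1%N.
Proof.
have [] := sweep_lstep_rk1 sw r0' rd'.
by rewrite size_rev /= subn0 subnn.
Qed.

Lemma rsweep_lorth : (forall j, (j < d.-1 - (s + m))%N -> lorth ns t j) ->
  forall j, (j < d.-1 - (s + m))%N -> lorth ns t' j.
Proof.
move=> lo j jlt; have [Hr Hc _] := sweep_lstep_fixed sw.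
rewrite size_rev -/d in Hr Hc.
have Hr' i : (i <= j.+1)%N -> rk t' i = rk t i.
  by move=> ij; have := Hr (d - i)%N; rewrite /= subKn; [apply|]; lia.
apply: lorth_eq (lo j jlt); rewrite ?Hr' // => a i b.
have := Hc (d.-1 - j)%N b i a; rewrite /= subKn; [apply|]; lia.
Qed.

Lemma rsweep_rorth : (forall j, (d.-1 - s < j < d)%N -> rorth ns t j) ->
  forall j, (d.-1 - (s + m) < j < d)%N -> rorth ns t' j.
Proof.
move=> ro j jlt; have [_ _ Hl] := sweep_lstep_fixed sw.
apply: Hl; last by rewrite -/d; lia.
move=> i hi; have := ro (d.-1 - i)%N; rewrite /rorth -/d subKn; [apply|]; lia.
Qed.

Lemma rsweep_exact ix : e = 0 -> ix \in mindices ns ->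
  tt_eval d t' ix = tt_eval d t ix.
Proof.
move=> e0 ixn; have [r0'' rd''] := rsweep_rk1; have [sz _] := mindicesP _ _ ixn.
have sw0 := sw; rewrite e0 in sw0.
have := sweep_lstep_exact sw0 r0' rd' (mem_mindices_rev ixn).
by rewrite size_rev !tt_eval_rev.
Qed.

(** [sweep_lstep_err_le] on the reversed TT: left and right orthogonality trade places, and the sum
    over multi-indices is reindexed by reversal. *)
Lemma rsweep_err_le :
  (forall j, (j < d.-1 - s)%N -> lorth ns t j) ->
  (forall j, (d.-1 - s < j < d)%N -> rorth ns t j) ->
  \sum_(ix <- mindices ns) (tt_eval d t ix - tt_eval d t' ix) ^+ 2 <= e *+ m.
Proof.
move=> lo ro; have [r0'' rd''] := rsweep_rk1.
apply: le_trans (sweep_lstep_err_le sw r0' rd' _ _).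
- rewrite big_mindices_rev; apply: ler_of_eq.
  rewrite big_seq [RHS]big_seq; apply: eq_bigr => ix /mindicesP [sz _].
  by rewrite size_rev !tt_eval_rev.
- by move=> i hi; have := ro (d.-1 - i)%N; rewrite /rorth -/d subKn; [apply|]; lia.
move=> i; rewrite size_rev -/d => hi; rewrite /rorth size_rev -/d revK.
apply: lorth_eq (lo (d.-1 - i)%N _); rewrite /= ?subKn //; lia.
Qed.

End RightSweep.

(** * The conversion procedure *)

Lemma sparse_tt_spec ns p A fib t :
  (2 <= size ns)%N -> (1 <= p <= size ns)%N ->
  fiber_enum ns p.-1 A fib -> sparse_tt ns p A fib t ->
  [/\ rk t 0 = 1%N, rk t (size ns) = 1%N,
      forall j, (j < p.-1)%N -> lorth ns t j,
      forall j, (p.-1 < j < size ns)%N -> rorth ns t j &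
      forall ix, ix \in mindices ns -> tt_eval (size ns) t ix = A ix].
Proof.
set d := size ns => d2 pd fibE [tm []]; rewrite -/d; set p0 := p.-1.
have p0d : (p0 < d)%N by lia.
set t0 := init_tt d p0 A fib => swL swR.
have r0 : rk t0 0 = 1%N by [].
have rd : rk t0 d = 1%N by rewrite /= eqxx orbT.
have swL' : sweep (lstep ns 0) (iota 0 p0) t0 tm.
  apply: conv_sweep => //.
  - rewrite -(map_id (iota 0 p0)); apply: (sweep_map (f := id)) swL => u u' k.
    by rewrite mem_iota => kp; apply: conv_step_left; rewrite -/d; lia.
  - by move=> p00; apply: init_unitcore.
  by move=> j jp; apply: init_diagcore => //; rewrite -/d; lia.
have [Hr Hc Hl] := sweep_lstep_fixed swL'; rewrite -/d in Hr Hc.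
have [r0m rdm] := sweep_lstep_rk1 swL' r0 rd.
have swR' : sweep (lstep (rev ns) 0) (iota 0 (d - p0.+1)) (revT d tm) (revT d t).
  apply: conv_sweep; first by rewrite size_rev -/d; lia.
  - have := @map_rev_iota d p0.+1 (d - p0.+1); rewrite subnKC // subnn => <- //.
    apply: (sweep_map (f := revT d)) swR => u u' k.
    by rewrite mem_rev mem_iota => kp; apply: conv_step_right; rewrite -/d; lia.
  (* The left sweep alters cores up to [p0] only, so the right sweep still meets the initial cores
     after [p0]. *)
  - move=> pd0; apply: unitcore_eq (init_unitcore_rev d2 p0d fibE _) => //.
    + by apply: Hr; lia.
    + by apply: Hr; lia.
    + by move=> a i b; apply: Hc; lia.
    by rewrite -/d; lia.
  move=> j jd; apply: diagcore_rev; rewrite -/d; first lia.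
  have : diagcore ns t0 (d.-1 - j) by apply: init_diagcore => //; rewrite -/d; lia.
  by apply: diagcore_eq => // *; [apply: Hr|apply: Hr|apply: Hc]; lia.
have sd : (0 + (d - p0.+1) < d)%N by lia.
have [r0t rdt] := rsweep_rk1 swR' r0m rdm.
split=> //.
- move=> j jp; apply: (rsweep_lorth swR') => //; last by rewrite -/d; lia.
  by move=> i hi; apply: Hl => //; rewrite -/d in hi; lia.
- move=> j jp; apply: (rsweep_rorth swR') => //; rewrite -/d; last lia.
  (* The sweep starts at the last core, so no core is required to be right-orthogonal beforehand. *)
  by move=> i hi; exfalso; lia.
move=> ix ixn; rewrite (rsweep_exact swR') // (sweep_lstep_exact swL') //.
exact: init_tt_eval.
Qed.

(** The first sweep costs at most [delta ^+ 2] for each of its [d - p] steps. The exact QR sweep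
    then restores right-orthogonality after mode [p0], and the second SVD sweep costs at most
    [delta ^+ 2] for each of its [p - 1] steps. *)
Lemma tt_round_static_err_le ns p (eps nrm : R) t t' :
  (2 <= size ns)%N -> (1 <= p <= size ns)%N -> 0 <= eps -> 0 <= nrm ->
  rk t 0 = 1%N -> rk t (size ns) = 1%N ->
  (forall j, (j < p.-1)%N -> lorth ns t j) ->
  (forall j, (p.-1 < j < size ns)%N -> rorth ns t j) ->
  tt_round_static ns p eps nrm t t' ->
  \sum_(ix <- mindices ns)
    (tt_eval (size ns) t ix - tt_eval (size ns) t' ix) ^+ 2 <= (eps * nrm) ^+ 2.
Proof.
set d := size ns => d2 pd eps0 nrm0 r0 rd lo ro [t1 [t2 []]]; rewrite -/d.
set p0 := p.-1; set delta := _ / _ * nrm => sw1 [sw2 sw3].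
have p0d : (p0 < d)%N by lia.
have {}sw1 : sweep (lstep ns (delta ^+ 2)) (iota p0 (d.-1 - p0)) t t1.
  rewrite -(map_id (iota _ _)); apply: (sweep_map (f := id)) sw1 => u u' k.
  by rewrite mem_iota => kp; apply: svd_step_left; rewrite -/d; lia.
have {}sw2 : sweep (lstep (rev ns) 0) (iota 0 (d - p0.+1)) (revT d t1) (revT d t2).
  have := @map_rev_iota d p0.+1 (d - p0.+1); rewrite subnKC // subnn => <- //.
  apply: (sweep_map (f := revT d)) sw2 => u u' k.
  by rewrite mem_rev mem_iota => kp; apply: qr_step_right; rewrite -/d; lia.
have {}sw3 : sweep (lstep (rev ns) (delta ^+ 2)) (iota (d - p0.+1) p0) (revT d t2) (revT d t').
  rewrite -[p0.+1]add1n -map_rev_iota; last by lia.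
  apply: (sweep_map (f := revT d)) sw3 => u u' k.
  by rewrite mem_rev mem_iota => kp; apply: svd_step_right; rewrite -/d; lia.
have [_ _ Hl1] := sweep_lstep_fixed sw1.
have [r01 rd1] := sweep_lstep_rk1 sw1 r0 rd.
have [r02 rd2] := rsweep_rk1 sw2 r01 rd1.
have lo1 j : (j < d.-1)%N -> lorth ns t1 j by move=> jd; apply: Hl1 => //; lia.
have lo2 j : (j < p0)%N -> lorth ns t2 j.
  move=> jp; apply: (rsweep_lorth sw2) => //; rewrite -/d; try lia.
  by move=> i hi; apply: lo1; lia.
have ro2 j : (p0 < j < d)%N -> rorth ns t2 j.
  by move=> jp; apply: (rsweep_rorth sw2) => //; rewrite -/d; [|move=> i hi; exfalso|]; lia.
have E1 := sweep_lstep_err_le sw1 r0 rd lo ro.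
have E3 : \sum_(ix <- mindices ns) (tt_eval d t1 ix - tt_eval d t' ix) ^+ 2
    <= delta ^+ 2 *+ p0.
  (* The QR sweep preserves the tensor, so [t1] may be traded for [t2], whose cores are orthogonal
     on both sides of [p0]. *)
  rewrite big_seq (eq_bigr (fun ix => (tt_eval d t2 ix - tt_eval d t' ix) ^+ 2)).
    rewrite -big_seq; apply: (rsweep_err_le sw3) => //; rewrite -/d.
    - lia.
    - by move=> j jp; apply: lo2; lia.
    - by move=> j jp; apply: ro2; lia.
  by move=> ix ixn; rewrite (rsweep_exact sw2) //; rewrite -/d; lia.
pose x : R := Num.sqrt (p - 1)%:R; pose y : R := Num.sqrt (d - p)%:R.
have x0 : 0 <= x by exact: sqrtr_ge0.
have y0 : 0 <= y by exact: sqrtr_ge0.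
(* The integers under the two roots add up to [d - 1 >= 1], so the denominator of [delta] is
   nonzero. *)
have xy0 : 0 < x + y.
  have [p1|p1] := ltnP 1 p.
    by rewrite ltr_wpDr // sqrtr_gt0 ltr0n; lia.
  by rewrite ltr_pwDr // sqrtr_gt0 ltr0n; lia.
have delta0 : 0 <= delta.
  by rewrite mulr_ge0 // divr_ge0 // ltW.
(* The choice of [delta] splits the tolerance into the shares of the first and the second SVD
   sweep. *)
have -> : eps * nrm = delta * y + delta * x.
  by rewrite /delta -/x -/y; field; rewrite gt_eqF.
rewrite (eq_bigr (fun ix => ((tt_eval d t ix - tt_eval d t1 ix) +
    (tt_eval d t1 ix - tt_eval d t' ix)) ^+ 2)); last first.
  by move=> ix _; rewrite addrA subrK.
apply: sum_sqrD_le; [exact: mulr_ge0|exact: mulr_ge0| |];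
  rewrite exprMn sqr_sqrtr ?ler0n // mulr_natr.
  by rewrite (_ : d - p = d.-1 - p0)%N //; lia.
by rewrite (_ : p - 1 = p0)%N //; lia.
Qed.

End StaticRounding.

Theorem theorem3 (R : realType) (ns : seq nat) (A : seq nat -> R) (p : nat)
    (eps : R) (fib : seq (seq nat)) (G B : TT R) :
  (2 <= size ns)%N -> (1 <= p <= size ns)%N -> 0 <= eps ->
  fiber_enum ns p.-1 A fib ->
  sparse_tt ns p A fib G ->
  tt_round_static ns p eps (normF ns A) G B ->
  normF ns (fun ix => A ix - tt_eval (size ns) B ix) <= eps * normF ns A.
Proof.
move=> d2 pd eps0 fibE sG rB.
have [r0 rd lo ro GA] := sparse_tt_spec d2 pd fibE sG.
have nA0 : 0 <= normF ns A by exact: sqrtr_ge0.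
move: (tt_round_static_err_le d2 pd eps0 nA0 r0 rd lo ro rB) => le.
rewrite -(ger0_norm (mulr_ge0 eps0 nA0)) -sqrtr_sqr.
apply: ler_wsqrtr; apply: le_trans le; apply: ler_of_eq.
(* The conversion is exact on in-range multi-indices, so [A] may replace the tensor of [G] inside
   the sum. *)
by rewrite big_seq [RHS]big_seq; apply: eq_bigr => ix /GA ->.
Qed.
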